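(* Let $\rho(\xi,\eta)=(\bar\eta,\bar\xi)$ and $\tau(\xi,\eta)=(\eta,\xi)$ on $\mathbb{C}^2$. Let $$\varphi:\ \xi'=\lambda\xi+p(\xi,\eta),\quad \eta'=\bar\lambda\eta+q(\xi,\eta),$$ where $p,q$ are convergent power series starting with terms of order two, $\operatorname{Im}\lambda>0$, and suppose $\varphi$ is reversible with respect to $\tau$ (i.e. $\varphi^{-1}=\tau\varphi\tau$) and satisfies $\rho\varphi=\varphi\rho$. If $\lambda$ is not a root of unity, then there exists a formal transformation $\Phi$ with $\rho\Phi=\Phi\rho$, $\tau\Phi=\Phi\tau$ and $$\Phi\varphi\Phi^{-1}:\ \xi'=\lambda\xi e^{i\epsilon(\xi\eta)^s},\quad \eta'=\bar\lambda\eta e^{-i\epsilon(\xi\eta)^s},$$ where either $\epsilon=\pm1$ and $s$ is a positive integer, or $\epsilon=0$ and $s=\infty$. Moreover $\{\lambda,\epsilon,s\}$ is a full set of invariants of $\varphi$ under real formal transformations: two such maps are conjugate by a formal transformation $\Psi$ with $\rho\Psi=\Psi\rho$ if and only if their triples $(\lambda,\epsilon,s)$ coincide.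
   Context: A formal transformation is a map $(\xi,\eta)\mapsto(f(\xi,\eta),g(\xi,\eta))$ given by formal power series without constant terms and with invertible linear part. A transformation $\Psi$ satisfying $\rho\Psi=\Psi\rho$ is called real (reality condition). The reversibility and reality conditions force $|\lambda|=1$. *)

(* Defs.v *)
(* complex numbers are R[i] (mathcomp-real-closed) over an
   abstract R : realType (MathComp-Analysis reals).  Formal power series in two
   variables (xi, eta) are coefficient arrays  f : nat -> nat -> R[i],
   f a b being the coefficient of xi^a eta^b. *)
From mathcomp Require Import all_boot all_algebra.
From mathcomp Require Import complex.
From mathcomp Require Import reals.
Set Implicit Arguments. Unset Strict Implicit. Unset Printing Implicit Defensive.
Import GRing.Theory Num.Theory.
Local Open Scope ring_scope.

Section FormalSeries.
Variable R : realType.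
Local Notation C := R[i].

Definition ser := nat -> nat -> C.
Definition fmap := (ser * ser)%type.

Definition ser_one : ser := fun a b => ((a == 0%N) && (b == 0%N))%:R.
Definition ser_X : ser := fun a b => ((a == 1%N) && (b == 0%N))%:R.
Definition ser_Y : ser := fun a b => ((a == 0%N) && (b == 1%N))%:R.

Definition ser_add (f g : ser) : ser := fun a b => f a b + g a b.
Definition ser_scale (c : C) (f : ser) : ser := fun a b => c * f a b.

Definition ser_mul (f g : ser) : ser := fun a b =>
  \sum_(i < a.+1) \sum_(j < b.+1) f i j * g (a - i)%N (b - j)%N.

Definition ser_pow (f : ser) (n : nat) : ser := iter n (ser_mul f) ser_one.

(* substitution f(g(xi,eta), h(xi,eta)); meaningful (and computed by a finite
   sum) when g and h have no constant term, which is always the case below *)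
Definition ser_comp (f g h : ser) : ser := fun a b =>
  \sum_(j < (a + b).+1) \sum_(k < (a + b).+1)
     f j k * ser_mul (ser_pow g j) (ser_pow h k) a b.

Definition fmap_comp (F G : fmap) : fmap :=
  (ser_comp F.1 G.1 G.2, ser_comp F.2 G.1 G.2).

Definition fmap_id : fmap := (ser_X, ser_Y).

Definition formal_transformation (F : fmap) : Prop :=
  F.1 0%N 0%N = 0 /\ F.2 0%N 0%N = 0 /\
  F.1 1%N 0%N * F.2 0%N 1%N - F.1 0%N 1%N * F.2 1%N 0%N != 0.

Definition convergent (f : ser) : Prop :=
  exists M r : C, 0 < r /\ forall a b, `|f a b| * r ^+ (a + b) <= M.

Definition order_ge2 (f : ser) : Prop :=
  forall a b, (a + b < 2)%N -> f a b = 0.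

Definition ser_swap (f : ser) : ser := fun a b => f b a.
Definition ser_conjswap (f : ser) : ser := fun a b => (f b a)^*.

Definition tau_conj (F : fmap) : fmap := (ser_swap F.2, ser_swap F.1).
(* rho(xi,eta) = (conj eta, conj xi):  rho o F o rho  (as formal series,
   (rho F rho)(xi,eta) = (conj F2(conj eta, conj xi), conj F1(conj eta, conj xi))) *)
Definition rho_conj (F : fmap) : fmap := (ser_conjswap F.2, ser_conjswap F.1).

(* rho F = F rho   (rho is an involution) *)
Definition commutes_rho (F : fmap) : Prop := rho_conj F = F.
Definition commutes_tau (F : fmap) : Prop := tau_conj F = F.
Definition reversible_tau (F : fmap) : Prop :=
  fmap_comp F (tau_conj F) = fmap_id /\ fmap_comp (tau_conj F) F = fmap_id.

Definition phi_map (lam : C) (p q : ser) : fmap :=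
  (ser_add (ser_scale lam ser_X) p, ser_add (ser_scale lam^* ser_Y) q).

Definition admissible (lam : C) (p q : ser) : Prop :=
  convergent p /\ convergent q /\ order_ge2 p /\ order_ge2 q /\
  0 < complex.Im lam /\
  reversible_tau (phi_map lam p q) /\ commutes_rho (phi_map lam p q) /\
  ~ (exists n : nat, (0 < n)%N /\ lam ^+ n = 1).

(* s in {1,2,...} U {oo}: None stands for s = infinity *)
Definition valid_invariants (eps : C) (s : option nat) : Prop :=
  (eps = 0 /\ s = None) \/
  ((eps = 1 \/ eps = -1) /\ exists n : nat, s = Some n /\ (0 < n)%N).

(* normal form  xi' = lam xi exp(i eps (xi eta)^s),
                eta' = conj(lam) eta exp(-i eps (xi eta)^s),
   expanded as formal power series; for s = oo (eps = 0) it is the linear map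
   (lam xi, conj(lam) eta).  The coefficient of xi^(1+s n) eta^(s n) in xi'
   is lam (i eps)^n / n!.  (s = Some 0 never occurs: excluded by
   valid_invariants.) *)
Definition normal_form (lam eps : C) (s : option nat) : fmap :=
  match s with
  | None => (ser_scale lam ser_X, ser_scale lam^* ser_Y)
  | Some s =>
    ((fun a b => if [&& (0 < s)%N, (s %| b)%N & a == b.+1]
                 then lam * ('i * eps) ^+ (b %/ s) / ((b %/ s)`!)%:R
                 else 0),
     (fun a b => if [&& (0 < s)%N, (s %| a)%N & b == a.+1]
                 then lam^* * (- ('i * eps)) ^+ (a %/ s) / ((a %/ s)`!)%:R
                 else 0))
  end.

End FormalSeries.

(* Main.v *)
Require Import Defs.
From HB Require Import structures.
From mathcomp Require Import all_boot all_order all_algebra.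
From mathcomp Require Import complex.
From mathcomp Require Import reals boolp.
From mathcomp Require Import zify ring.
Import Order.TTheory GRing.Theory Num.Theory.
Local Open Scope ring_scope.

Set Implicit Arguments.
Unset Strict Implicit.
Unset Printing Implicit Defensive.

(** Work with formal maps up to order n.  If L is the linear part of phi, the
    equation Phi phi = N Phi, with Phi - id nonresonant and N - L resonant, is a
    fixed point problem for an operator that gains one degree, so it has exactly
    one solution (Phi, N).  Uniqueness transfers the symmetries: rho Phi rho and
    tau Phi tau solve the same problem (for tau, with N replaced by the inverse
    of tau N tau), hence Phi commutes with rho and tau, and N tau N tau = id.

    As lambda is not a root of unity, a resonant N has the form
    (lambda X A, conj(lambda) Y B) with A, B series in u = XY; reality gives
    B = conj A and reversibility gives AB = 1, so A = exp(i k(u)) with k real.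
    If k = eps u^s |c| (1 + ...), a root D of eps k / u^s of order 2s turns k
    into eps u^s through the real symmetric map (X D, Y D).

    For the invariants, let Th be real and conjugate two such normal forms.  Its
    linear part gives lambda.  Comparing Th with L^-1 Th L, which conjugates the
    same maps, shows that Th is resonant, Th = (X A, Y conj A), and the angles
    satisfy eps1 u^s1 = eps2 (u |A|^2)^s2. *)

(** * Formal power series *)

(** The conjugacy to a resonant map is far from unique, since it may be followed by any resonant map
    tangent to the identity. Banning resonant terms from Phi - id removes this freedom, and rho and
    tau preserve that ban; this is what makes symmetry a consequence of uniqueness. Of the divisors
    lambda^a conj(lambda)^b - lambda only the nonvanishing matters, no estimate.

    AB = 1 is not immediate: N tau N tau = id multiplies B by A composed with tau N tau, so it first
    gives g (g o tau N tau) = 1 for g = AB; then g = 1 follows degree by degree from g(0) = 1.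

    The order 2s comes from (X D)(Y D) = u D^2. Since D is real, D^(2s) has a positive constant
    term: it absorbs |c| but not the sign, which is left as eps. The same positivity, now of
    |A(0)|^2, is why real conjugacies cannot change eps, while Im lambda > 0 keeps lambda from being
    exchanged with its conjugate. *)

Section SerRing.
Variable R : realType.
Local Notation C := R[i].
Local Notation ser := (ser R).

Lemma serP (f g : ser) : (forall a b, f a b = g a b) -> f = g.
Proof. by move=> fg; apply: funext => a; apply: funext => b; exact: fg. Qed.

Definition ser_zero : ser := fun _ _ => 0.
Definition ser_opp (f : ser) : ser := fun a b => - f a b.

(* The ring axioms are inherited from polynomials, coefficient by coefficient. *)
Definition ser_trunc (N : nat) (f : ser) : {poly {poly C}} :=
  \poly_(i < N) \poly_(j < N) f i j.

Lemma coef_ser_trunc N f a b : (a < N)%N -> (b < N)%N ->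
  (ser_trunc N f)`_a`_b = f a b.
Proof. by move=> aN bN; rewrite coef_poly aN coef_poly bN. Qed.

Lemma coef_ser_truncM N f g a b : (a < N)%N -> (b < N)%N ->
  (ser_trunc N f * ser_trunc N g)`_a`_b = ser_mul f g a b.
Proof.
move=> aN bN; rewrite coefM coef_sum; apply: eq_bigr => i _.
rewrite coefM; apply: eq_bigr => j _.
by rewrite !coef_ser_trunc //; move: (ltn_ord i) (ltn_ord j); lia.
Qed.

Lemma ser_addA : associative (@ser_add R).
Proof. by move=> f g h; apply: serP => a b; exact: addrA. Qed.

Lemma ser_addC : commutative (@ser_add R).
Proof. by move=> f g; apply: serP => a b; exact: addrC. Qed.

Lemma ser_add0 : left_id ser_zero (@ser_add R).
Proof. by move=> f; apply: serP => a b; exact: add0r. Qed.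

Lemma ser_addN : left_inverse ser_zero ser_opp (@ser_add R).
Proof. by move=> f; apply: serP => a b; exact: addNr. Qed.

Lemma ser_mulC : commutative (@ser_mul R).
Proof.
move=> f g; apply: serP => a b.
by rewrite -!(@coef_ser_truncM (a + b).+1) 1?mulrC //; lia.
Qed.

Lemma ser_mulA : associative (@ser_mul R).
Proof.
move=> f g h; apply: serP => a b; pose N := (a + b).+1.
transitivity ((ser_trunc N f * (ser_trunc N g * ser_trunc N h))`_a`_b).
  symmetry; rewrite coefM coef_sum; apply: eq_bigr => i _.
  rewrite [LHS]coefM; apply: eq_bigr => j _.
  by rewrite coef_ser_truncM ?coef_ser_trunc //;
    move: (ltn_ord i) (ltn_ord j); rewrite /N; lia.
rewrite mulrA coefM coef_sum; apply: eq_bigr => i _.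
rewrite [LHS]coefM; apply: eq_bigr => j _.
by rewrite coef_ser_truncM ?coef_ser_trunc //;
  move: (ltn_ord i) (ltn_ord j); rewrite /N; lia.
Qed.

Lemma ser_mul1 : left_id (ser_one R) (@ser_mul R).
Proof.
move=> f; apply: serP => a b; rewrite /ser_mul big_ord_recl big_ord_recl /=.
rewrite /ser_one !eqxx mul1r !subn0 big1 ?addr0 => [|i _]; last first.
  by rewrite mul0r.
by rewrite big1 ?addr0 // => i _; rewrite big1 // => j _; rewrite mul0r.
Qed.

Lemma ser_mulDl : left_distributive (@ser_mul R) (@ser_add R).
Proof.
move=> f g h; apply: serP => a b; rewrite /ser_mul /ser_add -big_split /=.
apply: eq_bigr => i _; rewrite -big_split /=.
by apply: eq_bigr => j _; rewrite mulrDl.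
Qed.

Lemma ser_oner_neq0 : ser_one R != ser_zero :> (nat -> nat -> C).
Proof.
apply/eqP => /(congr1 (fun f : ser => f 0%N 0%N)) /eqP.
by rewrite /ser_one /ser_zero oner_eq0.
Qed.

End SerRing.

HB.instance Definition _ (R : realType) := gen_eqMixin (ser R).
HB.instance Definition _ (R : realType) := gen_choiceMixin (ser R).
HB.instance Definition _ (R : realType) := GRing.isZmodule.Build (ser R)
  (@ser_addA R) (@ser_addC R) (@ser_add0 R) (@ser_addN R).
(** [ser_oner_neq0] is stated for the equality structure of the function type, not for the one just
    put on [ser]; the inequality therefore passes through Leibniz equality. *)
HB.instance Definition _ (R : realType) :=
  GRing.Zmodule_isComNzRing.Build (ser R)
    (@ser_mulA R) (@ser_mulC R) (@ser_mul1 R) (@ser_mulDl R)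
    (introN eqP (elimN eqP (@ser_oner_neq0 R))).

Section SerTheory.
Variable R : realType.
Local Notation C := R[i].
Local Notation ser := (ser R).
Local Notation X := (ser_X R).
Local Notation Y := (ser_Y R).
Implicit Types (f g h : ser).

Lemma serDE f g a b : (f + g) a b = f a b + g a b. Proof. by []. Qed.
Lemma serNE f a b : (- f) a b = - f a b. Proof. by []. Qed.
Lemma serBE f g a b : (f - g) a b = f a b - g a b. Proof. by []. Qed.
Lemma ser0E a b : (0 : ser) a b = 0. Proof. by []. Qed.
Lemma ser1E a b : (1 : ser) a b = ((a == 0%N) && (b == 0%N))%:R.
Proof. by []. Qed.

Lemma serME f g a b :
  (f * g) a b = \sum_(i < a.+1) \sum_(j < b.+1) f i j * g (a - i)%N (b - j)%N.
Proof. by []. Qed.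

Lemma ser_sumE I (r : seq I) (P : pred I) (F : I -> ser) a b :
  (\sum_(i <- r | P i) F i) a b = \sum_(i <- r | P i) F i a b.
Proof. by elim/big_rec2 : _ => // i x y _ <-. Qed.

Lemma ser_powE f n : ser_pow f n = f ^+ n.
Proof. by elim: n => //= n IHn; rewrite exprS -IHn. Qed.

Definition cst (c : C) : ser :=
  fun a b => if (a == 0%N) && (b == 0%N) then c else 0.

Lemma cstM c f a b : (cst c * f) a b = c * f a b.
Proof.
rewrite serME big_ord_recl big_ord_recl /= /cst !eqxx !subn0 /=.
rewrite big1 ?addr0 => [|i _]; last by rewrite mul0r.
by rewrite big1 ?addr0 // => i _; rewrite big1 // => j _; rewrite mul0r.
Qed.

Lemma scaleE c f : ser_scale c f = cst c * f.
Proof. by apply: serP => a b; rewrite cstM. Qed.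

Lemma cst_is_zmod : zmod_morphism cst.
Proof.
by move=> c d; apply: serP => a b; rewrite serBE /cst; case: ifP; rewrite ?subr0.
Qed.

Lemma cst_is_monoid : monoid_morphism cst.
Proof.
split=> [|c d]; apply: serP => a b; first by rewrite ser1E /cst; case: ifP.
by rewrite cstM /cst; case: ifP; rewrite ?mulr0.
Qed.

HB.instance Definition _ := GRing.isZmodMorphism.Build C ser cst cst_is_zmod.
HB.instance Definition _ := GRing.isMonoidMorphism.Build C ser cst cst_is_monoid.

Lemma mulXE f a b : (X * f) a b = if a is a'.+1 then f a' b else 0.
Proof.
rewrite serME; case: a => [|a].
  by rewrite big1 // => i _; rewrite big1 // => j _; rewrite ord1 mul0r.
rewrite big_ord_recl big1 ?add0r => [|j _]; last by rewrite mul0r.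
rewrite big_ord_recl big_ord_recl /= /ser_X !eqxx mul1r !subn0 subSS subn0.
rewrite big1 ?addr0 => [|i _]; last by rewrite mul0r.
by rewrite big1 ?addr0 // => i _; rewrite big1 // => j _; rewrite mul0r.
Qed.

Lemma mulYE f a b : (Y * f) a b = if b is b'.+1 then f a b' else 0.
Proof.
rewrite serME big_ord_recl [Z in _ + Z]big1 ?addr0 => [|i _]; last first.
  by rewrite big1 // => j _; rewrite mul0r.
case: b => [|b]; first by rewrite big_ord1 mul0r.
rewrite big_ord_recl mul0r add0r big_ord_recl /= /ser_Y !eqxx mul1r !subn0.
rewrite big1 ?addr0 => [|i _]; last by rewrite mul0r.
by rewrite subSS subn0.
Qed.

Lemma monomE j k a b : (X ^+ j * Y ^+ k) a b = ((a == j) && (b == k))%:R.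
Proof.
elim: j a => [|j IHj] a; last by rewrite exprS -mulrA mulXE; case: a.
rewrite mul1r; elim: k b => [|k IHk] b //.
by rewrite exprS mulYE; case: b => [|b]; rewrite ?andbF.
Qed.

(** Membership in the n-th power of the maximal ideal. All limits and fixed points below are taken
    for this filtration. *)
Definition ord (n : nat) f := forall a b, (a + b < n)%N -> f a b = 0.

Lemma ord_zero n : ord n 0. Proof. by []. Qed.
Lemma ord_ge0 f : ord 0 f. Proof. by []. Qed.

Lemma ordW m n f : ord n f -> (m <= n)%N -> ord m f.
Proof. by move=> nf mn a b abm; apply: nf; lia. Qed.

Lemma ordD n f g : ord n f -> ord n g -> ord n (f + g).
Proof. by move=> nf ng a b abn; rewrite serDE nf // ng // addr0. Qed.

Lemma ordN n f : ord n f -> ord n (- f).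
Proof. by move=> nf a b abn; rewrite serNE nf // oppr0. Qed.

Lemma ordB n f g : ord n f -> ord n g -> ord n (f - g).
Proof. by move=> nf ng; apply: ordD => //; apply: ordN. Qed.

Lemma ordM m n f g : ord m f -> ord n g -> ord (m + n) (f * g).
Proof.
move=> mf ng a b abmn; rewrite serME big1 // => i _; rewrite big1 // => j _.
have [ijm|mij] := ltnP (i + j) m; first by rewrite mf ?mul0r.
by rewrite ng ?mulr0 //; move: (ltn_ord i) (ltn_ord j); lia.
Qed.

Lemma ordMl n f g : ord n g -> ord n (f * g).
Proof. exact: (ordM (@ord_ge0 f)). Qed.

Lemma ordMr n f g : ord n f -> ord n (f * g).
Proof. by rewrite mulrC; exact: ordMl. Qed.

Lemma ordX n f : ord 1 f -> ord n (f ^+ n).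
Proof. by move=> f1; elim: n => // n IHn; rewrite exprS; exact: (ordM f1). Qed.

Lemma ord_eq f g : (forall n, ord n (f - g)) -> f = g.
Proof.
move=> fg; apply: serP => a b; apply/eqP; rewrite -subr_eq0 -serBE.
by rewrite (fg (a + b).+1).
Qed.

Lemma ord_X : ord 1 X. Proof. by case=> [|a] [|b]. Qed.
Lemma ord_Y : ord 1 Y. Proof. by case=> [|a] [|b]. Qed.

Lemma ord1P f : ord 1 f <-> f 0%N 0%N = 0.
Proof. by split=> [of1|f0]; [exact: of1 | case=> [|a] [|b]]. Qed.

(** Cutting along the square j, k < N, not along the total degree, keeps the sum a plain double sum;
    the remainder still has order N. *)
Definition ser_poly N f : ser :=
  \sum_(j < N) \sum_(k < N) cst (f j k) * (X ^+ j * Y ^+ k).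

Lemma ord_ser_poly N f : ord N (f - ser_poly N f).
Proof.
move=> a b abN; rewrite serBE /ser_poly ser_sumE.
have aN : (a < N)%N by lia.
have bN : (b < N)%N by lia.
rewrite (bigD1 (Ordinal aN)) //= ser_sumE (bigD1 (Ordinal bN)) //=.
rewrite cstM monomE !eqxx mulr1 !big1 ?addr0 ?subrr // => [i|j jb].
  move=> ia; rewrite ser_sumE big1 // => j _; rewrite cstM monomE.
  case: eqP => [ai|]; rewrite ?mulr0 //.
  by case/eqP: ia; apply: val_inj.
rewrite cstM monomE; case: (b =P _) => [bj|]; rewrite ?andbF ?mulr0 //.
by case/eqP: jb; apply: val_inj.
Qed.

End SerTheory.

Arguments ordX {R} n {f}.

(** * Substitution *)

Section Composition.
Variable R : realType.
Local Notation C := R[i].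
Local Notation ser := (ser R).
Local Notation X := (ser_X R).
Local Notation Y := (ser_Y R).
Implicit Types (f g h : ser).

Lemma ord_monom g h j k : ord 1 g -> ord 1 h -> ord (j + k) (g ^+ j * h ^+ k).
Proof. by move=> g1 h1; apply: ordM; apply: ordX. Qed.

Lemma ser_compE f g h a b : ser_comp f g h a b =
  \sum_(j < (a + b).+1) \sum_(k < (a + b).+1) f j k * (g ^+ j * h ^+ k) a b.
Proof.
by apply: eq_bigr => j _; apply: eq_bigr => k _; rewrite !ser_powE.
Qed.

(** The range of summation in [ser_comp] depends on the coefficient being read. As g^j h^k has order
    j + k, one range N serves all coefficients of degree below N. *)
Lemma comp_expand N f g h : ord 1 g -> ord 1 h ->
  ord N (ser_comp f g h -
         \sum_(j < N) \sum_(k < N) cst (f j k) * (g ^+ j * h ^+ k)).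
Proof.
move=> g1 h1 a b abN; rewrite serBE ser_compE ser_sumE; apply/eqP.
rewrite subr_eq0; apply/eqP.
pose F j k := f j k * (g ^+ j * h ^+ k) a b.
have F0 j k : (a + b < j + k)%N -> F j k = 0.
  by move=> abjk; rewrite /F (ord_monom g1 h1) ?mulr0.
transitivity (\sum_(j < N) \sum_(k < N) F j k); last first.
  by apply: eq_bigr => j _; rewrite ser_sumE; apply: eq_bigr => k _; rewrite cstM.
rewrite (big_ord_widen N (fun j => \sum_(k < (a + b).+1) F j k)) //.
rewrite big_mkcond; apply: eq_bigr => j _.
case: ifP => jab; last first.
  by rewrite big1 // => k _; rewrite F0 //; lia.
rewrite (big_ord_widen N (F j)) // big_mkcond; apply: eq_bigr => k _.
by case: ifP => // kab; rewrite F0 //; lia.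
Qed.

Section Fixed.
Variables g h : ser.
Hypotheses (g1 : ord 1 g) (h1 : ord 1 h).
Local Notation comp f := (ser_comp f g h).

Lemma compB f1 f2 : comp (f1 - f2) = comp f1 - comp f2.
Proof.
apply: serP => a b; rewrite serBE !ser_compE -sumrB; apply: eq_bigr => j _.
by rewrite -sumrB; apply: eq_bigr => k _; rewrite serBE mulrBl.
Qed.

Lemma comp0 : comp 0 = 0.
Proof. by have := compB 0 0; rewrite !subrr. Qed.

Lemma compN f : comp (- f) = - comp f.
Proof. by rewrite -sub0r compB comp0 sub0r. Qed.

Lemma compD f1 f2 : comp (f1 + f2) = comp f1 + comp f2.
Proof. by rewrite -{1}(opprK f2) compB compN opprK. Qed.

Lemma comp_sum I (r : seq I) (P : pred I) (F : I -> ser) :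
  comp (\sum_(i <- r | P i) F i) = \sum_(i <- r | P i) comp (F i).
Proof.
by elim/big_rec2: _ => [|i x y _ <-]; rewrite ?comp0 ?compD.
Qed.

Lemma compZ c f : comp (cst c * f) = cst c * comp f.
Proof.
apply: serP => a b; rewrite cstM !ser_compE mulr_sumr; apply: eq_bigr => j _.
by rewrite mulr_sumr; apply: eq_bigr => k _; rewrite cstM mulrA.
Qed.

Lemma comp_ord n f : ord n f -> ord n (comp f).
Proof.
move=> nf a b abn; rewrite ser_compE big1 // => j _; rewrite big1 // => k _.
have [jkn|njk] := ltnP (j + k) n; first by rewrite nf ?mul0r.
by rewrite (ord_monom g1 h1) ?mulr0 //; lia.
Qed.

Lemma comp_monom j k : comp (X ^+ j * Y ^+ k) = g ^+ j * h ^+ k.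
Proof.
(* Large enough for the index (j, k) itself to occur in the truncated sum. *)
apply: ord_eq => n; pose N := (n + j + k).+1.
apply: (@ordW _ _ N); last by rewrite /N; lia.
rewrite -[comp _](subrK (\sum_(j' < N) \sum_(k' < N)
  cst ((X ^+ j * Y ^+ k) j' k') * (g ^+ j' * h ^+ k'))) -addrA.
apply: ordD; first exact: comp_expand.
have jN : (j < N)%N by rewrite /N; lia.
have kN : (k < N)%N by rewrite /N; lia.
rewrite (bigD1 (Ordinal jN)) //= (bigD1 (Ordinal kN)) //=.
rewrite monomE !eqxx rmorph1 mul1r !big1 ?addr0 ?subrr // => [i|i ik].
  move=> ij; rewrite big1 // => l _; rewrite monomE.
  case: eqP => [e|_]; last by rewrite rmorph0 mul0r.
  by case/eqP: ij; apply: val_inj.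
rewrite monomE; case: (_ =P k) => [e|_]; last by rewrite andbF rmorph0 mul0r.
by case/eqP: ik; apply: val_inj.
Qed.

Lemma comp_poly N f :
  comp (ser_poly N f) = \sum_(j < N) \sum_(k < N) cst (f j k) * (g ^+ j * h ^+ k).
Proof.
rewrite /ser_poly comp_sum; apply: eq_bigr => j _.
by rewrite comp_sum; apply: eq_bigr => k _; rewrite compZ comp_monom.
Qed.

(** For truncations, bilinearity reduces the claim to monomials. The remainders have order n and
    substitution preserves order, so both sides agree to every order. *)
Lemma compM f1 f2 : comp (f1 * f2) = comp f1 * comp f2.
Proof.
have poly N : comp (ser_poly N f1 * ser_poly N f2) =
              comp (ser_poly N f1) * comp (ser_poly N f2).
  rewrite !comp_poly /ser_poly !big_distrl comp_sum; apply: eq_bigr => j _ /=.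
  rewrite !big_distrl comp_sum; apply: eq_bigr => k _ /=.
  rewrite !big_distrr comp_sum; apply: eq_bigr => j' _ /=.
  rewrite !big_distrr comp_sum; apply: eq_bigr => k' _ /=.
  rewrite [Z in comp Z](_ : _ = cst (f1 j k * f2 j' k') *
    (X ^+ (j + j') * Y ^+ (k + k'))); last by rewrite rmorphM !exprD; ring.
  by rewrite compZ comp_monom rmorphM !exprD; ring.
apply: ord_eq => n.
pose r1 := f1 - ser_poly n f1; pose r2 := f2 - ser_poly n f2.
have -> : comp (f1 * f2) - comp f1 * comp f2 =
    comp (r1 * f2 + ser_poly n f1 * r2)
    - (comp r1 * comp f2 + comp (ser_poly n f1) * comp r2).
  have -> : r1 * f2 + ser_poly n f1 * r2 =
            f1 * f2 - ser_poly n f1 * ser_poly n f2 by rewrite /r1 /r2; ring.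
  by rewrite !compB poly; ring.
have or1 : ord n r1 := @ord_ser_poly _ n f1.
have or2 : ord n r2 := @ord_ser_poly _ n f2.
apply: ordB; first by apply: comp_ord; apply: ordD; [apply: ordMr | apply: ordMl].
by apply: ordD; [apply: ordMr | apply: ordMl]; apply: comp_ord.
Qed.

Lemma compX : comp X = g.
Proof.
have -> : X = X ^+ 1 * Y ^+ 0 by rewrite expr1 expr0 mulr1.
by rewrite comp_monom expr1 expr0 mulr1.
Qed.

Lemma compY : comp Y = h.
Proof.
have -> : Y = X ^+ 0 * Y ^+ 1 by rewrite expr1 expr0 mul1r.
by rewrite comp_monom expr1 expr0 mul1r.
Qed.

Lemma comp1 : comp 1 = 1.
Proof. by have := comp_monom 0 0; rewrite !expr0 !mulr1. Qed.

Lemma comp_exp f n : comp (f ^+ n) = comp f ^+ n.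
Proof. by elim: n => [|n IHn]; rewrite ?comp1 // !exprS compM IHn. Qed.

End Fixed.

Lemma comp_id f : ser_comp f X Y = f.
Proof.
apply: ord_eq => n.
rewrite -[f in ser_comp f](subrK (ser_poly n f)) compD comp_poly; last 2 first.
- exact: ord_X.
- exact: ord_Y.
rewrite -addrA -[_ - f]opprB; apply: ordB; last exact: ord_ser_poly.
by apply: comp_ord; [exact: ord_X | exact: ord_Y | exact: ord_ser_poly].
Qed.

Lemma comp_assoc f g1 h1 g2 h2 :
    ord 1 g1 -> ord 1 h1 -> ord 1 g2 -> ord 1 h2 ->
  ser_comp (ser_comp f g1 h1) g2 h2 =
  ser_comp f (ser_comp g1 g2 h2) (ser_comp h1 g2 h2).
Proof.
move=> og1 oh1 og2 oh2.
have og : ord 1 (ser_comp g1 g2 h2) by apply: comp_ord.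
have oh : ord 1 (ser_comp h1 g2 h2) by apply: comp_ord.
apply: ord_eq => n; rewrite -(subrK (ser_poly n f) f).
have nf := @ord_ser_poly _ n f; move: (f - _) nf => r nr.
rewrite !compD !(comp_poly _ _ n) //.
set A := ser_comp (\sum_(j < n) _) _ _; set B := \sum_(j < n) _.
have -> : A = B.
  rewrite /A /B comp_sum; apply: eq_bigr => j _.
  rewrite comp_sum; apply: eq_bigr => k _.
  by rewrite compZ compM // !comp_exp.
rewrite opprD addrACA subrr addr0.
by apply: ordB; do ?apply: comp_ord.
Qed.

(** The difference is g - g' times a sum of products of i - 1 factors of order 1. *)
Lemma ordX_sub i k g g' : ord 1 g -> ord 1 g' -> (0 < k)%N -> ord k (g - g') ->
  ord (k + i).-1 (g ^+ i - g' ^+ i).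
Proof.
move=> g1 g1' k0 kg; elim: i => [|i IHi]; first by rewrite subrr.
have -> : g ^+ i.+1 - g' ^+ i.+1 = g * (g ^+ i - g' ^+ i) + (g - g') * g' ^+ i.
  by rewrite !exprS; ring.
apply: ordD; last by apply: ordW (ordM kg (ordX i g1')) _; lia.
by apply: ordW (ordM g1 IHi) _; lia.
Qed.

Arguments ordX_sub i {k g g'}.

(** Source of every gain of degree: changing the arguments at order k changes a monomial of degree d
    at order k + d - 1, which exceeds k as soon as d is at least 2. *)
Lemma comp_sub_ord m k f g h g' h' :
    ord 1 g -> ord 1 h -> ord 1 g' -> ord 1 h' -> (0 < k)%N -> ord m f ->
    ord k (g - g') -> ord k (h - h') ->
  ord (m + k).-1 (ser_comp f g h - ser_comp f g' h').
Proof.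
move=> og oh og' oh' k0 mf kg kh a b abmk.
rewrite serBE !ser_compE -sumrB big1 // => i _; rewrite -sumrB big1 // => j _.
have [ijm|mij] := ltnP (i + j) m; first by rewrite mf // !mul0r subr0.
have e : g ^+ i * h ^+ j - g' ^+ i * h' ^+ j =
  (g ^+ i - g' ^+ i) * h ^+ j + g' ^+ i * (h ^+ j - h' ^+ j) by ring.
rewrite -mulrBr -serBE e [Z in _ * Z](_ : _ = 0) ?mulr0 //.
suff H : ord (m + k).-1 ((g ^+ i - g' ^+ i) * h ^+ j +
   g' ^+ i * (h ^+ j - h' ^+ j)) by exact: H.
apply: ordD.
  have [->|i0] := posnP i; first by rewrite subrr mul0r.
  by apply: ordW (ordM (ordX_sub i og og' k0 kg) (ordX j oh)) _; lia.
have [->|j0] := posnP j; first by rewrite subrr mulr0.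
by apply: ordW (ordM (ordX i og') (ordX_sub j oh oh' k0 kh)) _; lia.
Qed.

End Composition.

Arguments ordX_sub {R} i {k g g'}.

(** * Formal maps and their inverses *)

Section FormalMaps.
Variable R : realType.
Local Notation C := R[i].
Local Notation ser := (ser R).
Local Notation X := (ser_X R).
Local Notation Y := (ser_Y R).
Implicit Types (f g h : ser) (F G H : fmap R).

Definition agree n F G := ord n (F.1 - G.1) /\ ord n (F.2 - G.2).

Lemma agree_trans n F G H : agree n F G -> agree n G H -> agree n F H.
Proof.
by move=> [FG1 FG2] [GH1 GH2]; split; [rewrite -(subrK G.1 F.1) -addrA|
  rewrite -(subrK G.2 F.2) -addrA]; apply: ordD.
Qed.

Lemma agree_sym n F G : agree n F G -> agree n G F.
Proof.
by move=> [FG1 FG2]; split; [rewrite -(opprB F.1)|rewrite -(opprB F.2)];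
  apply: ordN.
Qed.

Lemma agree_eq F G : (forall n, agree n F G) -> F = G.
Proof.
move=> FG; rewrite (surjective_pairing F) (surjective_pairing G).
by congr pair; apply: ord_eq => n; have [] := FG n.
Qed.

Definition contraction (T : fmap R -> fmap R) :=
  forall n F G, agree n F G -> agree n.+1 (T F) (T G).

Lemma contraction_unique T F G : contraction T -> T F = F -> T G = G -> F = G.
Proof.
move=> cT TF TG; apply: agree_eq; elim=> [|n IHn]; first by [].
by rewrite -TF -TG; exact: cT.
Qed.

(** Banach's argument for the adic distance, in which T has ratio 1/2 and any two maps agree to
    order 0. *)
Lemma contraction_fixpoint T : contraction T -> exists F, T F = F.
Proof.
move=> cT; pose I n := iter n T 0.
have I_agree n k : agree n (I n) (I (n + k)%N).
  by elim: n => [|n IHn]; [|exact: cT].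
(* The coefficients of degree d no longer change from iterate d + 1 on, so the limit reads them
   there. *)
pose L : fmap R :=
  (fun a b => (I (a + b).+1).1 a b, fun a b => (I (a + b).+1).2 a b).
have L_agree n : agree n L (I n).
  split=> a b abn; rewrite serBE /L /=;
    have [E1 E2] := I_agree (a + b).+1 (n - (a + b).+1)%N;
    rewrite subnKC // in E1 E2; [exact: E1|exact: E2].
exists L; apply: agree_eq => n; apply: (@agree_trans _ _ (I n.+1)).
  have [E1 E2] := cT _ _ _ (L_agree n).
  by split; [apply: ordW E1 _|apply: ordW E2 _].
have [E1 E2] := agree_sym (L_agree n.+1).
by split; [apply: ordW E1 _|apply: ordW E2 _].
Qed.

(* No constant term. *)
Definition nc F := ord 1 F.1 /\ ord 1 F.2.

Lemma nc_id : nc (fmap_id R).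
Proof. by split; [exact: ord_X|exact: ord_Y]. Qed.

Lemma nc_comp F G : nc F -> nc G -> nc (fmap_comp F G).
Proof. by move=> [? ?] [? ?]; split; apply: comp_ord. Qed.

Lemma fmap_compA F G H : nc G -> nc H ->
  fmap_comp (fmap_comp F G) H = fmap_comp F (fmap_comp G H).
Proof. by move=> [? ?] [? ?]; rewrite /fmap_comp !comp_assoc. Qed.

Lemma fmap_comp_id F : fmap_comp F (fmap_id R) = F.
Proof. by case: F => F1 F2; rewrite /fmap_comp !comp_id. Qed.

Lemma fmap_id_comp F : nc F -> fmap_comp (fmap_id R) F = F.
Proof. by case: F => F1 F2 [? ?]; rewrite /fmap_comp compX ?compY. Qed.

Lemma ord2_linear f : ord 1 f ->
  ord 2 (f - (cst (f 1%N 0%N) * X + cst (f 0%N 1%N) * Y)).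
Proof.
move=> f1 a b; rewrite serBE serDE !cstM.
case: a => [|[|a]]; case: b => [|[|b]] // _;
  rewrite /ser_X /ser_Y /= ?mulr0 ?mulr1 ?addr0 ?add0r ?subrr //.
by rewrite subr0 f1.
Qed.

Lemma comp_linear f g h a b : ord 1 f -> ord 1 g -> ord 1 h -> (a + b < 2)%N ->
  ser_comp f g h a b = f 1%N 0%N * g a b + f 0%N 1%N * h a b.
Proof.
move=> f1 g1 h1 ab2.
have := comp_ord g1 h1 (ord2_linear f1) ab2.
rewrite compB compD !compZ compX // compY // serBE serDE !cstM => /eqP.
by rewrite subr_eq0 => /eqP.
Qed.

Lemma formal_transformation_nc F : formal_transformation F -> nc F.
Proof. by case=> [? [? _]]; split; apply/ord1P. Qed.

Definition jacobian F :=
  F.1 1%N 0%N * F.2 0%N 1%N - F.1 0%N 1%N * F.2 1%N 0%N.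

Lemma jacobian_comp F G : nc F -> nc G ->
  jacobian (fmap_comp F G) = jacobian F * jacobian G.
Proof.
by move=> [? ?] [? ?]; rewrite /jacobian /= !comp_linear //; ring.
Qed.

Lemma formal_transformationP F :
  formal_transformation F <-> nc F /\ jacobian F != 0.
Proof.
split=> [tF|[[/ord1P F1 /ord1P F2] jF]]; last by [].
by split; [exact: formal_transformation_nc|case: tF => [_ []]].
Qed.

Lemma formal_transformation_comp F G : formal_transformation F ->
  formal_transformation G -> formal_transformation (fmap_comp F G).
Proof.
move=> /formal_transformationP[nF jF] /formal_transformationP[nG jG].
apply/formal_transformationP; split; first exact: nc_comp.
by rewrite jacobian_comp // mulf_neq0.
Qed.

(** A [contraction] must contract on all maps, whereas the estimates for substitution need arguments
    without low order terms. Cutting the argument reconciles the two, and changes nothing at the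
    fixed point once its order is known. *)
Definition cut n f : ser := fun a b => if (a + b < n)%N then 0 else f a b.

Lemma ord_cut n f : ord n (cut n f).
Proof. by move=> a b abn; rewrite /cut abn. Qed.

Lemma cut_id n f : ord n f -> cut n f = f.
Proof.
by move=> nf; apply: serP => a b; rewrite /cut; case: ifP => // /nf ->.
Qed.

Lemma ord_cut_sub k n f g : ord n (f - g) -> ord (maxn k n) (cut k f - cut k g).
Proof.
move=> fg a b abkn; rewrite serBE /cut; case: ltnP => kab; first by rewrite subrr.
by rewrite -serBE fg //; lia.
Qed.

(** Split F into its linear part and a remainder r of order 2. Then F G = id reads: G is the inverse
    linear part applied to id - r(G), and the right side gains a degree in G. Cramer's rule, with
    [e] the inverse determinant, gives the operator [T]. *)
Lemma right_inverse_exists F : formal_transformation F ->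
  exists2 G, nc G & fmap_comp F G = fmap_id R.
Proof.
move=> /formal_transformationP[[oF1 oF2] jF].
set a := F.1 1%N 0%N; set b := F.1 0%N 1%N.
set c := F.2 1%N 0%N; set d := F.2 0%N 1%N.
pose r1 := F.1 - (cst a * X + cst b * Y).
pose r2 := F.2 - (cst c * X + cst d * Y).
have or1 : ord 2 r1 := ord2_linear oF1.
have or2 : ord 2 r2 := ord2_linear oF2.
have F1E : F.1 = r1 + (cst a * X + cst b * Y) by rewrite subrK.
have F2E : F.2 = r2 + (cst c * X + cst d * Y) by rewrite subrK.
clearbody r1 r2.
pose e := cst (jacobian F)^-1.
pose U G := X - ser_comp r1 (cut 1 G.1) (cut 1 G.2).
pose V G := Y - ser_comp r2 (cut 1 G.1) (cut 1 G.2).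
pose T G : fmap R :=
  (e * (cst d * U G - cst b * V G), e * (cst a * V G - cst c * U G)).
have [|G TG] := @contraction_fixpoint T.
  move=> n G H [GH1 GH2].
  have comp_cut r : ord 2 r -> ord n.+1 (ser_comp r (cut 1 G.1) (cut 1 G.2)
      - ser_comp r (cut 1 H.1) (cut 1 H.2)).
    move=> or; apply: (@ordW _ _ (2 + maxn 1 n).-1); last by lia.
    apply: comp_sub_ord or _ _; [exact: ord_cut|exact: ord_cut|exact: ord_cut|
      exact: ord_cut|lia|exact: ord_cut_sub|exact: ord_cut_sub].
  have dU : ord n.+1 (U G - U H).
    by rewrite /U opprB addrC addrA subrK -opprB; apply/ordN/comp_cut.
  have dV : ord n.+1 (V G - V H).
    by rewrite /V opprB addrC addrA subrK -opprB; apply/ordN/comp_cut.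
  split=> /=; rewrite -mulrBr; apply: ordMl.
    have -> : cst d * U G - cst b * V G - (cst d * U H - cst b * V H) =
      cst d * (U G - U H) - cst b * (V G - V H) by ring.
    by apply: ordB; apply: ordMl.
  have -> : cst a * V G - cst c * U G - (cst a * V H - cst c * U H) =
    cst a * (V G - V H) - cst c * (U G - U H) by ring.
  by apply: ordB; apply: ordMl.
have oU : ord 1 (U G).
  apply: ordB; first exact: ord_X.
  apply: (@ordW _ _ 2) => //.
  by apply: comp_ord; [exact: ord_cut|exact: ord_cut|].
have oV : ord 1 (V G).
  apply: ordB; first exact: ord_Y.
  apply: (@ordW _ _ 2) => //.
  by apply: comp_ord; [exact: ord_cut|exact: ord_cut|].
have oG : nc G.
  by rewrite -TG; split; apply: ordMl; apply: ordB; apply: ordMl.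
exists G => //.
have [oG1 oG2] := oG.
have UG : U G = X - ser_comp r1 G.1 G.2 by rewrite /U !cut_id.
have VG : V G = Y - ser_comp r2 G.1 G.2 by rewrite /V !cut_id.
have G1 : G.1 = e * (cst d * U G - cst b * V G) by rewrite -[in LHS]TG.
have G2 : G.2 = e * (cst a * V G - cst c * U G) by rewrite -[in LHS]TG.
have ej : e * (cst a * cst d - cst b * cst c) = 1.
  by rewrite /e -!rmorphM -rmorphB -rmorphM mulVf // rmorph1.
have lin1 : cst a * G.1 + cst b * G.2 = U G.
  rewrite -[RHS]mul1r -ej {1}G1 {1}G2; ring.
have lin2 : cst c * G.1 + cst d * G.2 = V G.
  rewrite -[RHS]mul1r -ej {1}G1 {1}G2; ring.
rewrite /fmap_comp /fmap_id; congr pair.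
  by rewrite F1E compD compD !compZ compX // compY // lin1 UG addrC subrK.
by rewrite F2E compD compD !compZ compX // compY // lin2 VG addrC subrK.
Qed.

Lemma jacobian_id : jacobian (fmap_id R) = 1.
Proof. by rewrite /jacobian /= /ser_X /ser_Y /= mulr1 mulr0 subr0. Qed.

(** The right inverse G has a right inverse H in turn, and F = F (G H) = (F G) H = H. *)
Lemma inverse_exists F : formal_transformation F ->
  exists G, [/\ formal_transformation G, fmap_comp F G = fmap_id R &
    fmap_comp G F = fmap_id R].
Proof.
move=> tF; have [G nG FG] := right_inverse_exists tF.
have nF := formal_transformation_nc tF.
have tG : formal_transformation G.
  apply/formal_transformationP; split => //.
  have := jacobian_comp nF nG; rewrite FG jacobian_id => /eqP.
  by apply: contraTneq => ->; rewrite mulr0 oner_eq0.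
have [H nH GH] := right_inverse_exists tG.
exists G; split => //; suff -> : F = H by [].
by rewrite -(fmap_comp_id F) -GH -fmap_compA // FG fmap_id_comp.
Qed.

Lemma inverse_unique F G H : nc F -> nc G -> nc H ->
  fmap_comp G F = fmap_id R -> fmap_comp F H = fmap_id R -> G = H.
Proof.
by move=> nF nG nH GF FH; rewrite -(fmap_comp_id G) -FH -fmap_compA // GF
  fmap_id_comp.
Qed.

Lemma comp_injr F G H : formal_transformation F ->
  fmap_comp G F = fmap_comp H F -> G = H.
Proof.
move=> tF GHF; have [K [/formal_transformation_nc nK FK _]] := inverse_exists tF.
have nF := formal_transformation_nc tF.
by rewrite -(fmap_comp_id G) -(fmap_comp_id H) -FK -!fmap_compA // GHF.
Qed.

Lemma comp_injl F G H : formal_transformation F -> nc G -> nc H ->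
  fmap_comp F G = fmap_comp F H -> G = H.
Proof.
move=> tF nG nH GHF.
have [K [/formal_transformation_nc nK _ KF]] := inverse_exists tF.
have nF := formal_transformation_nc tF.
by rewrite -(fmap_id_comp nG) -(fmap_id_comp nH) -KF !fmap_compA // GHF.
Qed.

End FormalMaps.

(** * Resonant normal form *)

Section NormalForm.
Variable R : realType.
Local Notation C := R[i].
Local Notation ser := (ser R).
Local Notation X := (ser_X R).
Local Notation Y := (ser_Y R).
Implicit Types (f g h r s F W : ser).

Definition lin (lam : C) : fmap R := (cst lam * X, cst lam^* * Y).

Lemma nc_lin lam : nc (lin lam).
Proof. by split; apply: ordMl; [exact: ord_X|exact: ord_Y]. Qed.

Lemma comp_lin lam f a b :
  ser_comp f (lin lam).1 (lin lam).2 a b = lam ^+ a * lam^* ^+ b * f a b.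
Proof.
have E j k : ((lin lam).1 ^+ j * (lin lam).2 ^+ k) a b =
    lam ^+ j * lam^* ^+ k * ((a == j) && (b == k))%:R.
  rewrite -monomE -cstM; congr ((_ : ser) a b).
  by rewrite /= !exprMn rmorphM !rmorphXn; ring.
have aS : (a < (a + b).+1)%N by lia.
have bS : (b < (a + b).+1)%N by lia.
rewrite ser_compE (bigD1 (Ordinal aS)) //= (bigD1 (Ordinal bS)) //= E !eqxx.
rewrite mulr1 [RHS]mulrC !big1 ?addr0 // => [j ja|k kb].
  rewrite big1 // => k _; rewrite E; case: eqP => [e|]; rewrite ?mulr0 //.
  by case/eqP: ja; apply: val_inj.
rewrite E; case: (b =P _) => [e|]; last by rewrite andbF !mulr0.
by case/eqP: kb; apply: val_inj.
Qed.

Definition restrict (P : nat -> nat -> bool) f : ser :=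
  fun a b => if P a b then f a b else 0.

Lemma restrictB P f g : restrict P f - restrict P g = restrict P (f - g).
Proof. by apply: serP => a b; rewrite !serBE /restrict; case: ifP; rewrite ?subrr. Qed.

Lemma ord_restrict n P f : ord n f -> ord n (restrict P f).
Proof. by move=> nf a b abn; rewrite /restrict nf // if_same. Qed.

(** Exponents for which X^a Y^b has the same eigenvalue under composition with [lin lam] as X (for
    [res2], as Y), when |lam| = 1 and lam is not a root of unity. *)
Definition res1 a b := a == b.+1.
Definition res2 a b := b == a.+1.

Definition resonant (N : fmap R) :=
  (forall a b, ~~ res1 a b -> N.1 a b = 0) /\
  (forall a b, ~~ res2 a b -> N.2 a b = 0).

Definition normalized (Phi : fmap R) :=
  [/\ agree 2 Phi (fmap_id R),
      forall a b, (1 < a + b)%N -> res1 a b -> Phi.1 a b = 0 &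
      forall a b, (1 < a + b)%N -> res2 a b -> Phi.2 a b = 0].

Lemma agree2_nc (F G : fmap R) : agree 2 F G -> nc G -> nc F.
Proof.
move=> [FG1 FG2] [G1 G2]; split.
  by rewrite -(subrK G.1 F.1); apply: ordD G1; exact: ordW FG1 _.
by rewrite -(subrK G.2 F.2); apply: ordD G2; exact: ordW FG2 _.
Qed.

Variable lam : C.
Hypothesis lam_unit : lam * lam^* = 1.
Hypothesis lam_nroot : forall n, (0 < n)%N -> lam ^+ n <> 1.

Lemma lam_neq0 : lam != 0.
Proof.
by apply: contraTneq isT => l0; move: lam_unit; rewrite l0 mul0r => /esym/eqP;
  rewrite oner_eq0.
Qed.

Lemma lam_expI m n : lam ^+ m = lam ^+ n -> m = n.
Proof.
wlog mn : m n / (m <= n)%N.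
  by move=> H; case: (leqP m n) => [/H //|/ltnW /H {}H /esym /H].
move=> E; have : lam ^+ (n - m) = 1.
  by apply: (mulIf (expf_neq0 m lam_neq0)); rewrite mul1r -exprD subnK.
by case: (posnP (n - m)%N) => [|/lam_nroot //]; lia.
Qed.

(** Multiplied by lam^b, the vanishing becomes lam^a = lam^(b+1), and distinct powers of lam
    differ. *)
Lemma small_div1 a b : ~~ res1 a b -> lam ^+ a * lam^* ^+ b - lam != 0.
Proof.
apply: contraNneq => /eqP; rewrite subr_eq0 => /eqP E.
apply/eqP/lam_expI; transitivity (lam ^+ a * lam^* ^+ b * lam ^+ b).
  by rewrite -mulrA -exprMn [_ * lam]mulrC lam_unit expr1n mulr1.
by rewrite E exprS.
Qed.

Lemma small_div2 a b : ~~ res2 a b -> lam ^+ a * lam^* ^+ b - lam^* != 0.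
Proof.
apply: contraNneq => /eqP; rewrite subr_eq0 => /eqP E.
apply/eqP/lam_expI; transitivity (lam * lam^* * lam ^+ b).
  by rewrite lam_unit mul1r.
rewrite -{1}E exprS.
transitivity (lam * lam ^+ a * (lam * lam^*) ^+ b); first by rewrite exprMn; ring.
by rewrite lam_unit expr1n mulr1.
Qed.

Section Component.
(** Both components of the conjugacy equation are treated at once: (P, mu, W) is ([res1], lam, X) or
    ([res2], conj lam, Y). *)
Variables (P : nat -> nat -> bool) (mu : C) (W : ser).
Hypothesis small_div : forall a b, ~~ P a b -> lam ^+ a * lam^* ^+ b - mu != 0.
Hypothesis W_eigen : ser_comp W (lin lam).1 (lin lam).2 = cst mu * W.

Definition res_part F := restrict P F.
Definition nonres_part F := restrict (fun a b => ~~ P a b) F.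

(* The part of the degree n terms of the conjugacy equation that only involves
   coefficients of lower degree. *)
Definition nf_error (phi Phi : fmap R) f r :=
  (ser_comp r Phi.1 Phi.2 - r) -
  (ser_comp f phi.1 phi.2 - ser_comp f (lin lam).1 (lin lam).2).

(** Inverse of the homological operator of [hom_invP]. Nonresonant coefficients are divided by their
    divisor; the resonant ones, which stand for N - L on the other side of the equation, only change
    sign. *)
Definition hom_inv s : ser := fun a b =>
  if P a b then - s a b else s a b / (lam ^+ a * lam^* ^+ b - mu).

Lemma hom_invP F s : hom_inv s = F <->
  ser_comp (nonres_part F) (lin lam).1 (lin lam).2 - cst mu * nonres_part F
    - res_part F = s.
Proof.
have E a b : (ser_comp (nonres_part F) (lin lam).1 (lin lam).2
    - cst mu * nonres_part F - res_part F) a b =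
    if P a b then - F a b else (lam ^+ a * lam^* ^+ b - mu) * F a b.
  rewrite !serBE comp_lin cstM /nonres_part /res_part /restrict.
  by case: (P a b); rewrite /= ?mulr0 ?subr0 ?sub0r // mulrBl.
split=> [FE|<-]; apply: serP => a b.
  rewrite E -FE /hom_inv; case Pab: (P a b); rewrite ?opprK // mulrC divfK //.
  by apply: small_div; rewrite Pab.
rewrite /hom_inv E; case Pab: (P a b); rewrite ?opprK // mulrC mulKf //.
by apply: small_div; rewrite Pab.
Qed.

(** Replacing phi by L on the left and Phi by id in the resonant term on the right leaves exactly
    the homological operator; the two corrections make up [nf_error]. *)
Lemma nf_equation phi Phi F : nc Phi -> nc phi ->
    ser_comp W Phi.1 Phi.2 = W + nonres_part F ->
  (ser_comp (W + nonres_part F) phi.1 phi.2 =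
   ser_comp (cst mu * W + res_part F) Phi.1 Phi.2) <->
  hom_inv (nf_error phi Phi (W + nonres_part F) (res_part F)) = F.
Proof.
move=> nPhi nphi WPhi; rewrite hom_invP /nf_error.
rewrite [ser_comp (cst mu * W + _) _ _]compD compZ WPhi.
rewrite (compD (lin lam).1) W_eigen.
set u := ser_comp (W + _) _ _; set v := ser_comp _ (lin lam).1 _.
set w := ser_comp _ Phi.1 _; set n := nonres_part F; set r := res_part F.
split=> [->|/esym/eqP E]; first by ring.
apply/eqP; move: E; rewrite -subr_eq0 => /eqP E; rewrite -subr_eq0 -oppr_eq0.
by rewrite -E; apply/eqP; ring.
Qed.

(** The change of the error splits into three differences, each pairing an order n with an order 2,
    either in the outer series or between the inner arguments. By [comp_sub_ord] each has order n +
    1. *)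
Lemma nf_error_sub n phi Phi Phi' f f' r r' : (1 < n)%N ->
    agree 2 phi (lin lam) -> nc phi ->
    agree 2 Phi (fmap_id R) -> agree 2 Phi' (fmap_id R) -> nc Phi -> nc Phi' ->
    agree n Phi Phi' -> ord n (f - f') -> ord 2 r' -> ord n (r - r') ->
  ord n.+1 (nf_error phi Phi f r - nf_error phi Phi' f' r').
Proof.
move=> n1 [phi1 phi2] [? ?] [Phi1 Phi2] [Phi'1 Phi'2] [? ?] [? ?] [d1 d2] ff r2 rr.
have [? ?] := nc_lin lam.
have -> : nf_error phi Phi f r - nf_error phi Phi' f' r' =
    (ser_comp (r - r') Phi.1 Phi.2 - ser_comp (r - r') X Y)
    + (ser_comp r' Phi.1 Phi.2 - ser_comp r' Phi'.1 Phi'.2)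
    - (ser_comp (f - f') phi.1 phi.2
       - ser_comp (f - f') (lin lam).1 (lin lam).2).
  by rewrite /nf_error comp_id !compB; ring.
apply: ordB; first apply: ordD.
- apply: (@ordW _ _ (n + 2).-1); last by lia.
  by apply: comp_sub_ord => //; [exact: ord_X|exact: ord_Y].
- apply: (@ordW _ _ (2 + n).-1); last by lia.
  by apply: comp_sub_ord => //; lia.
- apply: (@ordW _ _ (n + 2).-1); last by lia.
  by apply: comp_sub_ord.
Qed.

Lemma nf_error_ord phi Phi f r :
    agree 2 phi (lin lam) -> nc phi -> agree 2 Phi (fmap_id R) -> nc Phi ->
    ord 1 f -> ord 2 r ->
  ord 2 (nf_error phi Phi f r).
Proof.
move=> [phi1 phi2] [? ?] [Phi1 Phi2] [? ?] f1 r2; have [? ?] := nc_lin lam.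
rewrite /nf_error -{2}(comp_id r); apply: ordB.
  apply: (@ordW _ _ (2 + 2).-1) => //.
  by apply: comp_sub_ord => //; [exact: ord_X|exact: ord_Y].
apply: (@ordW _ _ (1 + 2).-1) => //; exact: comp_sub_ord.
Qed.

Lemma ord_hom_inv n s : ord n s -> ord n (hom_inv s).
Proof.
by move=> ns a b abn; rewrite /hom_inv ns // oppr0 mul0r if_same.
Qed.

Lemma hom_inv_sub n s s' : ord n (s - s') -> ord n (hom_inv s - hom_inv s').
Proof.
move=> ss; have -> : hom_inv s - hom_inv s' = hom_inv (s - s').
  apply: serP => a b; rewrite serBE /hom_inv; case: ifP => _.
    by rewrite serBE opprB opprK addrC.
  by rewrite serBE mulrBl.
exact: ord_hom_inv.
Qed.

End Component.

Lemma X_eigen : ser_comp X (lin lam).1 (lin lam).2 = cst lam * X.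
Proof. by have [? ?] := nc_lin lam; rewrite compX. Qed.

Lemma Y_eigen : ser_comp Y (lin lam).1 (lin lam).2 = cst lam^* * Y.
Proof. by have [? ?] := nc_lin lam; rewrite compY. Qed.

(* One pair F encodes both unknowns: its nonresonant coefficients are those of
   Phi - id, its resonant ones those of N - L. *)
Definition tangent_id (F : fmap R) : fmap R :=
  (X + nonres_part res1 F.1, Y + nonres_part res2 F.2).

Definition nf_map (F : fmap R) : fmap R :=
  (cst lam * X + res_part res1 F.1, cst lam^* * Y + res_part res2 F.2).

Definition nf_step phi (F : fmap R) : fmap R :=
  (hom_inv res1 lam (nf_error phi (tangent_id F) (tangent_id F).1
     (res_part res1 F.1)),
   hom_inv res2 lam^* (nf_error phi (tangent_id F) (tangent_id F).2
     (res_part res2 F.2))).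

Lemma tangent_id_agree (F : fmap R) : ord 2 F.1 -> ord 2 F.2 ->
  agree 2 (tangent_id F) (fmap_id R).
Proof.
by move=> F1 F2; split; rewrite /= addrAC subrr add0r; exact: ord_restrict.
Qed.

Lemma nf_stepP phi (F : fmap R) : nc phi -> ord 2 F.1 -> ord 2 F.2 ->
  (fmap_comp (tangent_id F) phi = fmap_comp (nf_map F) (tangent_id F)) <->
  nf_step phi F = F.
Proof.
move=> nphi F1 F2; have nT := agree2_nc (tangent_id_agree F1 F2) (@nc_id R).
have [? ?] := nT.
have E1 := @nf_equation _ _ _ small_div1 X_eigen phi (tangent_id F) F.1 nT nphi.
have E2 := @nf_equation _ _ _ small_div2 Y_eigen phi (tangent_id F) F.2 nT nphi.
rewrite compX // in E1; rewrite compY // in E2.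
have {}E1 := E1 erefl; have {}E2 := E2 erefl.
split=> H.
  rewrite [RHS]surjective_pairing; congr pair.
    by apply/E1; have := congr1 fst H.
  by apply/E2; have := congr1 snd H.
by congr pair; [apply/E1; have := congr1 fst H|apply/E2; have := congr1 snd H].
Qed.

Definition cut2 (F : fmap R) : fmap R := (cut 2 F.1, cut 2 F.2).

Lemma nf_step_contraction phi : agree 2 phi (lin lam) ->
  contraction (fun F : fmap R => nf_step phi (cut2 F)).
Proof.
move=> aphi n F G [FG1 FG2]; have nphi := agree2_nc aphi (nc_lin lam).
have c1 := @ord_cut_sub _ 2 _ _ _ FG1; have c2 := @ord_cut_sub _ 2 _ _ _ FG2.
have oF := @tangent_id_agree (cut2 F) (@ord_cut _ _ _) (@ord_cut _ _ _).
have oG := @tangent_id_agree (cut2 G) (@ord_cut _ _ _) (@ord_cut _ _ _).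
have nF := agree2_nc oF (@nc_id R); have nG := agree2_nc oG (@nc_id R).
have a : agree (maxn 2 n) (tangent_id (cut2 F)) (tangent_id (cut2 G)).
  split; rewrite /= opprD addrACA subrr add0r /nonres_part restrictB;
  exact: ord_restrict.
have [a1 a2] := a.
(* [nf_error_sub] starts at degree 2; the cuts supply agreement up to there for free. *)
split; apply: (@ordW _ _ (maxn 2 n).+1); try lia; apply: hom_inv_sub;
  apply: nf_error_sub => //; try lia; rewrite /res_part ?restrictB;
  apply: ord_restrict => //; exact: ord_cut.
Qed.

Lemma nf_step_ord phi (F : fmap R) :
    agree 2 phi (lin lam) -> ord 2 F.1 -> ord 2 F.2 ->
  ord 2 (nf_step phi F).1 /\ ord 2 (nf_step phi F).2.
Proof.
move=> aphi F1 F2; have nphi := agree2_nc aphi (nc_lin lam).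
have oF := tangent_id_agree F1 F2; have nF := agree2_nc oF (@nc_id R).
have [? ?] := nF.
by split; apply: ord_hom_inv; apply: nf_error_ord => //; exact: ord_restrict.
Qed.

Lemma nf_exists phi : agree 2 phi (lin lam) -> exists Phi N,
  [/\ normalized Phi, resonant N, agree 2 N (lin lam) &
      fmap_comp Phi phi = fmap_comp N Phi].
Proof.
move=> aphi; have [F FE] := contraction_fixpoint (nf_step_contraction aphi).
have [F1 F2] : ord 2 F.1 /\ ord 2 F.2.
  by rewrite -FE; apply: nf_step_ord => //; exact: ord_cut.
have cF : cut2 F = F by case: F F1 F2 {FE} => *; rewrite /cut2 !cut_id.
rewrite cF in FE; exists (tangent_id F), (nf_map F); split.
- split; first exact: tangent_id_agree.
    move=> a b ab E; rewrite /= serDE /nonres_part /restrict E addr0 /ser_X.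
    by move: E ab; case: a => [|[|a]]; case: b.
  move=> a b ab E; rewrite /= serDE /nonres_part /restrict E addr0 /ser_Y.
  by move: E ab; case: b => [|[|b]]; case: a.
- split=> a b E; rewrite /= serDE cstM /res_part /restrict (negbTE E) addr0;
    move: E; rewrite /ser_X /ser_Y /res1 /res2;
    by case: a b => [|[|a]] [|[|b]]; rewrite //= ?mulr0.
- by split; rewrite /= addrAC subrr add0r; exact: ord_restrict.
- by apply/nf_stepP => //; exact: agree2_nc aphi (nc_lin lam).
Qed.

(** Phi - id and N - L have disjoint supports, so their sum determines both. Every solution thus
    arises from a fixed point, and uniqueness carries over. *)
Lemma nf_encode Phi N : normalized Phi -> resonant N -> agree 2 N (lin lam) ->
  exists F : fmap R,
    [/\ ord 2 F.1, ord 2 F.2, Phi = tangent_id F & N = nf_map F].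
Proof.
case: Phi => P Q; case: N => M N.
move=> [[/= oP oQ] Pr Qr] [/= Mr Nr] [/= oM oN].
exists ((P - X) + (M - cst lam * X), (Q - Y) + (N - cst lam^* * Y)).
split; [exact: ordD|exact: ordD| |]; congr pair; apply: serP => a b;
  rewrite /= serDE /nonres_part /res_part /restrict ?cstM.
- case: ifP => E.
    rewrite serDE !serBE cstM (Mr _ _ E).
    have -> : X a b = 0 by move: E; rewrite /ser_X; case: a b => [|[|a]] [|b].
    by rewrite mulr0 !subr0 addr0 add0r.
  rewrite addr0; have [ab|ab] := ltnP 1 (a + b); last first.
    by apply/eqP; rewrite -subr_eq0 -serBE oP.
  rewrite Pr ?(negbFE E) // /ser_X.
  by move: ab E; case: a b => [|[|a]] [|b].
- case: ifP => E.
    rewrite serDE !serBE cstM (Nr _ _ E).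
    have -> : Y a b = 0 by move: E; rewrite /ser_Y; case: b a => [|[|b]] [|a].
    by rewrite mulr0 !subr0 addr0 add0r.
  rewrite addr0; have [ab|ab] := ltnP 1 (a + b); last first.
    by apply/eqP; rewrite -subr_eq0 -serBE oQ.
  rewrite Qr ?(negbFE E) // /ser_Y.
  by move: ab E; case: b a => [|[|b]] [|a].
- case: ifP => E.
    rewrite serDE !serBE cstM [P a b - X a b](_ : _ = 0).
      by rewrite add0r addrC subrK.
    have [ab|ab] := ltnP 1 (a + b); last by rewrite -serBE oP.
    by rewrite Pr // /ser_X; move: ab E; case: a b => [|[|a]] [|b] //; rewrite subr0.
  rewrite (Mr _ _ (negbT E)) addr0 /ser_X; move: E.
  by case: a b => [|[|a]] [|b]; rewrite //= mulr0.
- case: ifP => E.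
    rewrite serDE !serBE cstM [Q a b - Y a b](_ : _ = 0).
      by rewrite add0r addrC subrK.
    have [ab|ab] := ltnP 1 (a + b); last by rewrite -serBE oQ.
    by rewrite Qr // /ser_Y; move: ab E; case: b a => [|[|b]] [|a] //; rewrite subr0.
  rewrite (Nr _ _ (negbT E)) addr0 /ser_Y; move: E.
  by case: b a => [|[|b]] [|a]; rewrite //= mulr0.
Qed.

Lemma nf_unique phi Phi N Phi' N' : agree 2 phi (lin lam) ->
    normalized Phi -> resonant N -> agree 2 N (lin lam) ->
    fmap_comp Phi phi = fmap_comp N Phi ->
    normalized Phi' -> resonant N' -> agree 2 N' (lin lam) ->
    fmap_comp Phi' phi = fmap_comp N' Phi' ->
  Phi = Phi' /\ N = N'.
Proof.
move=> aphi nP rN aN E nP' rN' aN' E'.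
have nphi := agree2_nc aphi (nc_lin lam).
have [F [F1 F2 PF NF]] := nf_encode nP rN aN.
have [G [G1 G2 PG NG]] := nf_encode nP' rN' aN'.
suff FG : F = G by rewrite PF NF PG NG FG.
have cut2E (H : fmap R) : ord 2 H.1 -> ord 2 H.2 -> cut2 H = H.
  by case: H => *; rewrite /cut2 !cut_id.
apply: (contraction_unique (nf_step_contraction aphi)).
  by rewrite cut2E //; apply/nf_stepP; rewrite // -PF -NF.
by rewrite cut2E //; apply/nf_stepP; rewrite // -PG -NG.
Qed.

End NormalForm.

(** * Reality and reversibility *)

Section Symmetries.
Variable R : realType.
Local Notation C := R[i].
Local Notation ser := (ser R).
Local Notation X := (ser_X R).
Local Notation Y := (ser_Y R).
Implicit Types (f g h : ser) (F G N Phi : fmap R).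

Definition ser_conj f : ser := fun a b => (f a b)^*.

Lemma ser_conjM f g : ser_conj (f * g) = ser_conj f * ser_conj g.
Proof.
apply: serP => a b; rewrite /ser_conj !serME rmorph_sum; apply: eq_bigr => i _.
by rewrite rmorph_sum; apply: eq_bigr => j _; rewrite rmorphM.
Qed.

Lemma ser_conjB f g : ser_conj (f - g) = ser_conj f - ser_conj g.
Proof. by apply: serP => a b; rewrite /ser_conj !serBE rmorphB. Qed.

Lemma ser_conjN f : ser_conj (- f) = - ser_conj f.
Proof. by apply: serP => a b; rewrite /ser_conj !serNE rmorphN. Qed.

Lemma ser_conj_cst c : ser_conj (cst c) = cst c^*.
Proof. by apply: serP => a b; rewrite /ser_conj /cst; case: ifP; rewrite ?rmorph0. Qed.

Lemma ser_conj1 : ser_conj 1 = 1.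
Proof. by apply: serP => a b; rewrite /ser_conj ser1E rmorph_nat. Qed.

Lemma ser_conj_X : ser_conj X = X.
Proof. by apply: serP => a b; rewrite /ser_conj /ser_X rmorph_nat. Qed.

Lemma ser_conj_Y : ser_conj Y = Y.
Proof. by apply: serP => a b; rewrite /ser_conj /ser_Y rmorph_nat. Qed.

Lemma ser_conjX f n : ser_conj (f ^+ n) = ser_conj f ^+ n.
Proof. by elim: n => [|n IHn]; rewrite ?ser_conj1 // !exprS ser_conjM IHn. Qed.

Lemma ser_conj_comp f g h :
  ser_conj (ser_comp f g h) = ser_comp (ser_conj f) (ser_conj g) (ser_conj h).
Proof.
apply: serP => a b; rewrite {1}/ser_conj !ser_compE rmorph_sum.
apply: eq_bigr => j _; rewrite rmorph_sum; apply: eq_bigr => k _.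
by rewrite rmorphM -(ser_conjX g) -(ser_conjX h) -ser_conjM.
Qed.

Lemma ord_conj n f : ord n f -> ord n (ser_conj f).
Proof. by move=> nf a b abn; rewrite /ser_conj nf // rmorph0. Qed.

Lemma ser_swapM f g : ser_swap (f * g) = ser_swap f * ser_swap g.
Proof. by apply: serP => a b; rewrite /ser_swap !serME exchange_big. Qed.

Lemma ser_swapB f g : ser_swap (f - g) = ser_swap f - ser_swap g.
Proof. by []. Qed.

Lemma ser_swap_cst (c : C) : ser_swap (cst c) = cst c.
Proof. by apply: serP => a b; rewrite /ser_swap /cst andbC. Qed.

Lemma ser_swap1 : ser_swap 1 = 1 :> ser.
Proof. by apply: serP => a b; rewrite /ser_swap !ser1E andbC. Qed.

Lemma ser_swap_X : ser_swap X = Y.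
Proof. by apply: serP => a b; rewrite /ser_swap /ser_X /ser_Y andbC. Qed.

Lemma ser_swap_Y : ser_swap Y = X.
Proof. by apply: serP => a b; rewrite /ser_swap /ser_X /ser_Y andbC. Qed.

Lemma ser_swapX f n : ser_swap (f ^+ n) = ser_swap f ^+ n.
Proof. by elim: n => [|n IHn]; rewrite ?ser_swap1 // !exprS ser_swapM IHn. Qed.

Lemma ser_swap_comp f g h :
  ser_swap (ser_comp f g h) = ser_comp f (ser_swap g) (ser_swap h).
Proof.
apply: serP => a b; rewrite {1}/ser_swap !ser_compE [(b + a)%N]addnC.
apply: eq_bigr => j _; apply: eq_bigr => k _.
by rewrite -(ser_swapX g) -(ser_swapX h) -ser_swapM.
Qed.

Lemma comp_swap f g h : ser_comp (ser_swap f) g h = ser_comp f h g.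
Proof.
apply: serP => a b; rewrite !ser_compE exchange_big /=.
apply: eq_bigr => j _; apply: eq_bigr => k _.
by rewrite mulrC [g ^+ _ * _]mulrC mulrC.
Qed.

Lemma ord_swap n f : ord n f -> ord n (ser_swap f).
Proof. by move=> nf a b abn; apply: nf; rewrite addnC. Qed.

Lemma conjswapE f : ser_conjswap f = ser_conj (ser_swap f).
Proof. by []. Qed.

Lemma tau_comp F G : tau_conj (fmap_comp F G) = fmap_comp (tau_conj F) (tau_conj G).
Proof. by rewrite /tau_conj /fmap_comp /= !ser_swap_comp (comp_swap F.1) (comp_swap F.2). Qed.

Lemma rho_comp F G : rho_conj (fmap_comp F G) = fmap_comp (rho_conj F) (rho_conj G).
Proof.
rewrite /rho_conj /fmap_comp /= !conjswapE !ser_swap_comp !ser_conj_comp.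
by rewrite -(comp_swap (ser_conj F.1)) -(comp_swap (ser_conj F.2)).
Qed.

Lemma tau_id : tau_conj (fmap_id R) = fmap_id R.
Proof. by rewrite /tau_conj /= ser_swap_X ser_swap_Y. Qed.

Lemma rho_id : rho_conj (fmap_id R) = fmap_id R.
Proof.
by rewrite /rho_conj /= !conjswapE ser_swap_X ser_swap_Y ser_conj_X ser_conj_Y.
Qed.

Lemma nc_tau F : nc F -> nc (tau_conj F).
Proof. by move=> [? ?]; split; apply: ord_swap. Qed.

Lemma nc_rho F : nc F -> nc (rho_conj F).
Proof. by move=> [? ?]; split; apply/ord_conj/ord_swap. Qed.

Lemma agree_tau n F G : agree n F G -> agree n (tau_conj F) (tau_conj G).
Proof. by move=> [? ?]; split; rewrite /= -ser_swapB; apply: ord_swap. Qed.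

Lemma agree_rho n F G : agree n F G -> agree n (rho_conj F) (rho_conj G).
Proof.
by move=> [? ?]; split; rewrite /= !conjswapE -ser_conjB -ser_swapB;
  apply/ord_conj/ord_swap.
Qed.

Lemma rho_inverse F G : nc F -> nc G -> fmap_comp F G = fmap_id R ->
  fmap_comp G F = fmap_id R -> commutes_rho F -> commutes_rho G.
Proof.
move=> nF nG FG GF rF; apply: (inverse_unique nF (nc_rho nG) nG) => //.
by rewrite -[in LHS]rF -rho_comp GF rho_id.
Qed.

Lemma rho_lin (lam : C) : rho_conj (lin lam) = lin lam.
Proof.
rewrite /rho_conj /lin /= !conjswapE !ser_swapM !ser_conjM !ser_swap_cst.
by rewrite ser_swap_X ser_swap_Y !ser_conj_cst ser_conj_X ser_conj_Y conjCK.
Qed.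

Lemma normalized_tau Phi : normalized Phi -> normalized (tau_conj Phi).
Proof.
move=> [P1 P2 P3]; split.
- by rewrite -tau_id; exact: agree_tau.
- by move=> a b ab r; apply: P3 => //; rewrite addnC.
- by move=> a b ab r; apply: P2 => //; rewrite addnC.
Qed.

Lemma normalized_rho Phi : normalized Phi -> normalized (rho_conj Phi).
Proof.
move=> [P1 P2 P3]; split.
- by rewrite -rho_id; exact: agree_rho.
- by move=> a b ab r; rewrite /= /ser_conjswap P3 ?rmorph0 // addnC.
- by move=> a b ab r; rewrite /= /ser_conjswap P2 ?rmorph0 // addnC.
Qed.

Lemma resonant_tau N : resonant N -> resonant (tau_conj N).
Proof. by move=> [N1 N2]; split=> a b r; [exact: N2|exact: N1]. Qed.

Lemma resonant_rho N : resonant N -> resonant (rho_conj N).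
Proof.
by move=> [N1 N2]; split=> a b r; rewrite /= /ser_conjswap ?N2 ?N1 // rmorph0.
Qed.

Section Lambda.
Variable lam : C.
Hypothesis lam_unit : lam * lam^* = 1.
Hypothesis lam_nroot : forall n, (0 < n)%N -> lam ^+ n <> 1.
Local Notation L := (lin lam).

(** N L - L N multiplies each coefficient by its divisor, which vanishes exactly on resonant
    exponents. This turns a condition on supports into one that inverses and conjugations
    respect. *)
Lemma resonant_commutes N : nc N ->
  resonant N <-> fmap_comp N L = fmap_comp L N.
Proof.
move=> [N1 N2]; split=> [[r1 r2]|].
  congr pair; apply: serP => a b; rewrite comp_lin /= compZ cstM.
    rewrite compX //; have [E|E] := boolP (res1 a b); last by rewrite r1 ?mulr0.
    by rewrite (eqP E) exprS -(mulrA lam) -exprMn lam_unit expr1n mulr1.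
  rewrite compY //; have [E|E] := boolP (res2 a b); last by rewrite r2 ?mulr0.
  rewrite (eqP E); congr (_ * _).
  transitivity (lam^* * (lam * lam^*) ^+ a); first by rewrite exprMn exprS; ring.
  by rewrite lam_unit expr1n mulr1.
case=> E1 E2; split=> a b r.
  have := congr1 (fun f : ser => f a b) E1.
  rewrite comp_lin /= compZ cstM compX // => /eqP.
  by rewrite -subr_eq0 -mulrBl mulf_eq0 (negbTE (small_div1 _ _ r)) //= => /eqP.
have := congr1 (fun f : ser => f a b) E2.
rewrite comp_lin /= compZ cstM compY // => /eqP.
by rewrite -subr_eq0 -mulrBl mulf_eq0 (negbTE (small_div2 _ _ r)) //= => /eqP.
Qed.

Lemma agree_lin_formal_transformation F : agree 2 F L -> formal_transformation F.
Proof.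
move=> aF; apply/formal_transformationP; split.
  exact: agree2_nc aF (nc_lin lam).
have E1 a b : (a + b < 2)%N -> F.1 a b = L.1 a b.
  by move=> ab; apply/eqP; rewrite -subr_eq0 -serBE aF.1.
have E2 a b : (a + b < 2)%N -> F.2 a b = L.2 a b.
  by move=> ab; apply/eqP; rewrite -subr_eq0 -serBE aF.2.
rewrite /jacobian !E1 // !E2 // /lin /= !cstM /ser_X /ser_Y /=.
by rewrite !mulr1 !mulr0 subr0 lam_unit oner_neq0.
Qed.

Lemma inverse_resonant M N : nc M -> nc N -> resonant M ->
    fmap_comp M N = fmap_id R -> fmap_comp N M = fmap_id R ->
  resonant N.
Proof.
move=> nM nN rM MN NM; apply/resonant_commutes => //.
have ML := (resonant_commutes nM).1 rM.
have nL := nc_lin lam.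
have nNL := nc_comp nN nL; have nLN := nc_comp nL nN.
rewrite -[LHS](fmap_comp_id) -MN -fmap_compA // (fmap_compA N) // -ML.
by rewrite -!fmap_compA // NM fmap_id_comp.
Qed.

(** The linear part of tau N tau is diag(conj lam, lam), whose inverse is L because |lam| = 1. *)
Lemma tau_inverse_agree N K : agree 2 N L -> nc K ->
  fmap_comp K (tau_conj N) = fmap_id R -> agree 2 K L.
Proof.
move=> aN [K1 K2] KN.
have nN := agree2_nc aN (nc_lin lam); have [t1 t2] := nc_tau nN.
have E1 a b : (a + b < 2)%N -> N.2 b a = L.2 b a.
  by move=> ab; apply/eqP; rewrite -subr_eq0 -serBE aN.2 // addnC.
have E2 a b : (a + b < 2)%N -> N.1 b a = L.1 b a.
  by move=> ab; apply/eqP; rewrite -subr_eq0 -serBE aN.1 // addnC.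
have J f a b : ord 1 f -> (a + b < 2)%N ->
    ser_comp f (tau_conj N).1 (tau_conj N).2 a b =
    f 1%N 0%N * (lam^* * X a b) + f 0%N 1%N * (lam * Y a b).
  move=> f1 ab; rewrite comp_linear // /tau_conj /ser_swap /= E1 // E2 //.
  by rewrite /lin /= !cstM /ser_X /ser_Y ![(b == _) && _]andbC.
have H1 := congr1 fst KN; have H2 := congr1 snd KN.
rewrite /= in H1 H2.
have A10 := J K.1 1%N 0%N K1 erefl; have A01 := J K.1 0%N 1%N K1 erefl.
have B10 := J K.2 1%N 0%N K2 erefl; have B01 := J K.2 0%N 1%N K2 erefl.
rewrite H1 /ser_X /ser_Y /= !mulr0 !mulr1 ?addr0 ?add0r in A10 A01.
rewrite H2 /ser_X /ser_Y /= !mulr0 !mulr1 ?addr0 ?add0r in B10 B01.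
have l0 := lam_neq0 lam_unit; have lc0 : lam^* != 0 by rewrite conjC_eq0.
split=> -[|[|a]] [|[|b]] //= _; rewrite serBE cstM /ser_X /ser_Y /=
  ?mulr0 ?mulr1 ?subr0; [exact: K1| | |exact: K2| |].
- by move/esym/eqP: A01; rewrite mulf_eq0 (negbTE l0) orbF => /eqP.
- by apply/eqP; rewrite subr_eq0 -(inj_eq (mulIf lc0)) -A10 lam_unit.
- by apply/eqP; rewrite subr_eq0 -(inj_eq (mulIf l0)) -B01 mulrC lam_unit.
- by move/esym/eqP: B10; rewrite mulf_eq0 (negbTE lc0) orbF => /eqP.
Qed.

Lemma nf_symmetric phi : agree 2 phi L -> commutes_rho phi ->
    reversible_tau phi ->
  exists Phi N, [/\ normalized Phi /\ (commutes_rho Phi /\ commutes_tau Phi),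
    resonant N, agree 2 N L, fmap_comp Phi phi = fmap_comp N Phi &
    commutes_rho N /\ fmap_comp N (tau_conj N) = fmap_id R].
Proof.
move=> aphi rphi [phi_tau tau_phi].
have [Phi [N [nPhi rN aN E]]] := nf_exists lam_unit lam_nroot aphi.
have uniq := nf_unique lam_unit lam_nroot aphi nPhi rN aN E.
exists Phi, N.
have [rhoP rhoN] : Phi = rho_conj Phi /\ N = rho_conj N.
  apply: uniq; [exact: normalized_rho|exact: resonant_rho| |].
    by rewrite -rho_lin; exact: agree_rho.
  by rewrite -{1}rphi -!rho_comp E.
have ncN := agree2_nc aN (nc_lin lam).
have nctN := nc_tau ncN.
have ncP : nc Phi := agree2_nc (let: And3 a _ _ := nPhi in a) (@nc_id R).
have ncphi := agree2_nc aphi (nc_lin lam).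
have tN : formal_transformation (tau_conj N).
  apply/formal_transformationP; split=> //.
  have /formal_transformationP[_] := agree_lin_formal_transformation aN.
  rewrite /jacobian /= /ser_swap; apply: contraNneq => e.
  by apply/eqP; rewrite -[RHS]e; ring.
have [K [/formal_transformation_nc nK NK KN]] := inverse_exists tN.
have [tauP tauN] : Phi = tau_conj Phi /\ N = K.
  apply: uniq; [exact: normalized_tau| | |].
  - exact: (inverse_resonant nctN nK (resonant_tau rN) NK KN).
  - exact: tau_inverse_agree KN.
  (* Applying tau to Phi phi = N Phi gives an equation for tau phi tau, the inverse of phi.
     Composing with [K] on the left and phi on the right brings phi back. *)
  - have H : tau_conj Phi = fmap_comp K (fmap_comp (tau_conj Phi) (tau_conj phi)).
      rewrite -tau_comp E tau_comp -fmap_compA ?KN ?fmap_id_comp //; exact: nc_tau.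
    have nct := nc_tau ncphi; have ncPt := nc_tau ncP.
    rewrite {1}H fmap_compA ?fmap_compA ?tau_phi ?fmap_comp_id //.
    exact: nc_comp.
have tN_id : fmap_comp N (tau_conj N) = fmap_id R by rewrite {1}tauN.
by split.
Qed.

End Lambda.
End Symmetries.

(** * Series in the product of the variables, exponential *)

Section Diagonal.
Variable R : realType.
Local Notation C := R[i].
Local Notation ser := (ser R).
Local Notation X := (ser_X R).
Local Notation Y := (ser_Y R).
Implicit Types (f g h A B : ser).

Definition diag A := forall a b, a != b -> A a b = 0.

Lemma diag0 : diag 0. Proof. by []. Qed.

Lemma diag_cst c : diag (cst c).
Proof. by move=> [|a] [|b] ab; rewrite /cst. Qed.

Lemma diagD A B : diag A -> diag B -> diag (A + B).
Proof. by move=> dA dB a b ab; rewrite serDE dA // dB // addr0. Qed.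

Lemma diagN A : diag A -> diag (- A).
Proof. by move=> dA a b ab; rewrite serNE dA // oppr0. Qed.

Lemma diagM A B : diag A -> diag B -> diag (A * B).
Proof.
move=> dA dB a b ab; rewrite serME big1 // => i _; rewrite big1 // => j _.
have [ij|ij] := eqVneq (i : nat) (j : nat); last by rewrite dA ?mul0r.
rewrite dB ?mulr0 //; apply: contraNneq ab => E.
by move: (ltn_ord i) (ltn_ord j) E ij; lia.
Qed.

Lemma diag1 : diag 1. Proof. by move=> [|a] [|b]. Qed.

Lemma diagX n A : diag A -> diag (A ^+ n).
Proof.
by move=> dA; elim: n => [|n IHn]; [exact: diag1|rewrite exprS; exact: diagM].
Qed.

Lemma diag_conj A : diag A -> diag (ser_conj A).
Proof. by move=> dA a b ab; rewrite /ser_conj dA // rmorph0. Qed.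

Lemma diag_swap A : diag A -> ser_swap A = A.
Proof.
move=> dA; apply: serP => a b; rewrite /ser_swap.
by have [->//|ab] := eqVneq a b; rewrite !dA // eq_sym.
Qed.

Lemma diag_comp f g : diag g -> diag (ser_comp f g 0).
Proof.
move=> dg a b ab; rewrite ser_compE big1 // => j _; rewrite big1 // => k _.
by rewrite (diagM (diagX _ dg) (diagX _ diag0)) ?mulr0.
Qed.

(* A diagonal series is a series in XY. *)
Lemma diag_comp_eq A g h g' h' : diag A -> g * h = g' * h' ->
  ser_comp A g h = ser_comp A g' h'.
Proof.
move=> dA gh; apply: serP => a b; rewrite !ser_compE.
apply: eq_bigr => j _; apply: eq_bigr => k _.
have [->|jk] := eqVneq (j : nat) (k : nat); last by rewrite !dA ?mul0r.
by rewrite -!exprMn gh.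
Qed.

Lemma coef00M f g : (f * g) 0%N 0%N = f 0%N 0%N * g 0%N 0%N.
Proof. by rewrite serME !big_ord1. Qed.

Lemma coef00X f n : (f ^+ n) 0%N 0%N = f 0%N 0%N ^+ n.
Proof. by elim: n => [|n IHn] //; rewrite !exprS coef00M IHn. Qed.

Lemma mulX_inj f g : X * f = X * g -> f = g.
Proof.
move=> E; apply: serP => a b.
by have := congr1 (fun u : ser => u a.+1 b) E; rewrite !mulXE.
Qed.

Lemma mulY_inj f g : Y * f = Y * g -> f = g.
Proof.
move=> E; apply: serP => a b.
by have := congr1 (fun u : ser => u a b.+1) E; rewrite !mulYE.
Qed.

Lemma mulXYn n f a b :
  ((X * Y) ^+ n * f) a b =
  if (n <= a)%N && (n <= b)%N then f (a - n)%N (b - n)%N else 0.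
Proof.
elim: n a b => [|n IHn] a b; first by rewrite expr0 mul1r !subn0.
rewrite exprS -!mulrA mulXE; case: a => [|a] //; rewrite mulYE.
by case: b => [|b]; rewrite ?andbF // IHn.
Qed.

Section OneVariable.
Variable f : ser.
Hypotheses (f1 : ord 1 f) (f10 : f 1%N 0%N != 0).

(** Obtained by inverting the planar map (f, Y). Setting Y = 0 afterwards yields the inversion of g
    |-> f(g, 0) in the next two lemmas. *)
Lemma one_variable_inverse : exists2 G : ser, ord 1 G &
  ser_comp f G Y = X /\ ser_comp G f Y = X.
Proof.
have tF : formal_transformation (f, Y).
  apply/formal_transformationP; split; first by split=> //; exact: ord_Y.
  by rewrite /jacobian /= /ser_Y /= mulr1 mulr0 subr0.
have [[G H] [/formal_transformation_nc [/= G1 H1] [E1 E2] [E3 E4]]] :=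
  inverse_exists tF.
by exists G => //; move: E1; rewrite compY // in E2; rewrite E2.
Qed.

Lemma comp1_inj g g' : ord 1 g -> ord 1 g' ->
  ser_comp f g 0 = ser_comp f g' 0 -> g = g'.
Proof.
move=> og og' E; have [G oG [_ Gf]] := one_variable_inverse.
have H k : ord 1 k -> k = ser_comp G (ser_comp f k 0) 0.
  move=> ok; rewrite -{1}(compX ok (@ord_zero R 1)) -Gf comp_assoc //; last exact: ord_Y.
  by rewrite compY.
by rewrite (H g) // E -H.
Qed.

(** Common source of logarithms and n-th roots. Reality comes from injectivity, since the conjugate
    of g solves the same equation. *)
Lemma comp1_surj k : ord 1 k -> exists g,
  [/\ ord 1 g, ser_comp f g 0 = k, diag k -> diag g &
      ser_conj f = f -> ser_conj k = k -> ser_conj g = g].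
Proof.
move=> ok; have [G oG [fG _]] := one_variable_inverse.
pose g := ser_comp G k 0.
have og : ord 1 g by apply: comp_ord.
have fg : ser_comp f g 0 = k.
  rewrite /g -{2}(compY ok (@ord_zero R 1)) -comp_assoc ?fG ?compX //.
  exact: ord_Y.
exists g; split=> // [dk|rf rk]; first exact: diag_comp.
apply: comp1_inj => //; first exact: ord_conj.
rewrite fg -[RHS]rk -fg ser_conj_comp rf; congr ser_comp.
by apply: serP => a b; rewrite /ser_conj rmorph0.
Qed.

End OneVariable.

Definition expS : ser := fun a b => if b == 0%N then a`!%:R^-1 else 0.
Local Notation Exp g := (ser_comp expS g 0).

Lemma ser_exp_coef g a b :
  Exp g a b = \sum_(j < (a + b).+1) j`!%:R^-1 * (g ^+ j) a b.
Proof.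
rewrite ser_compE; apply: eq_bigr => j _.
rewrite big_ord_recl big1 ?addr0 ?mulr1 // => k _.
by rewrite mul0r.
Qed.

Lemma ser_conj0 : ser_conj 0 = 0 :> ser.
Proof. by apply: serP => a b; rewrite /ser_conj rmorph0. Qed.

Lemma ser_conj_Exp g : ser_conj (Exp g) = Exp (ser_conj g).
Proof.
rewrite ser_conj_comp ser_conj0; congr ser_comp.
apply: serP => a b; rewrite /ser_conj /expS; case: ifP => _; rewrite ?rmorph0 //.
by rewrite fmorphV rmorph_nat.
Qed.

Lemma Exp0 : Exp 0 = 1.
Proof.
apply: serP => a b; rewrite ser_exp_coef big_ord_recl big1 ?addr0 => [|j _].
  by rewrite expr0 fact0 invr1 mul1r.
by rewrite exprS mul0r ser0E mulr0.
Qed.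

Lemma Exp_coef00 g : Exp g 0%N 0%N = 1.
Proof. by rewrite ser_exp_coef big_ord1 fact0 invr1 mul1r. Qed.

Lemma ExpNX : expS * Exp (- X) = 1.
Proof.
have E a b : Exp (- X) a b = if b == 0%N then (-1) ^+ a / a`!%:R else 0.
  rewrite ser_exp_coef.
  have XE j : ((- X) ^+ j) a b = (-1) ^+ j * ((a == j) && (b == 0%N))%:R.
    rewrite -monomE expr0 mulr1 -cstM; congr ((_ : ser) a b).
    by rewrite (exprNn X) rmorphXn rmorphN1.
  have aS : (a < (a + b).+1)%N by lia.
  rewrite (bigD1 (Ordinal aS)) //= XE eqxx big1 ?addr0 => [|j ja].
    by case: (b == 0%N); rewrite ?mulr1 ?mulr0 // mulrC.
  rewrite XE; case: (a =P _) => [e|]; rewrite ?mulr0 //.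
  by case/eqP: ja; apply: val_inj.
apply: serP => a b; rewrite serME ser1E.
have [->|b0] := eqVneq b 0%N; last first.
  rewrite andbF big1 // => i _; rewrite big1 // => j _; rewrite E /expS.
  case: eqP => [j0|]; rewrite ?mul0r // j0 subn0 (negbTE b0) mulr0 //.
(* The convolution of the two exponential series is the binomial expansion of (1 - 1)^a over a!. *)
rewrite andbT; transitivity ((1 - 1) ^+ a / a`!%:R : C); last first.
  by rewrite subrr expr0n; case: a => [|a] /=; rewrite ?divr1 ?mul0r.
rewrite [1 - 1]addrC exprDn mulr_suml; apply: eq_bigr => i _.
rewrite big_ord1 E /expS /= expr1n mulr1.
have ia : (i <= a)%N by rewrite -ltnS.
rewrite -(bin_fact ia) !natrM -mulr_natr.
have nz n : (n`!%:R : C) != 0 by rewrite pnatr_eq0 -lt0n fact_gt0.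
have bz : ('C(a, i)%:R : C) != 0 by rewrite pnatr_eq0 -lt0n bin_gt0.
by field; rewrite ?nz ?bz.
Qed.

Lemma ExpN g : ord 1 g -> Exp g * Exp (- g) = 1.
Proof.
move=> og; have o0 := @ord_zero R 1.
rewrite -(comp1 og o0) -ExpNX compM // comp_assoc ?comp0 //; last first.
  by apply: ordN; exact: ord_X.
by rewrite compN compX.
Qed.

(** [expS] has constant term 1; [expS - 1] has none and has linear coefficient 1, so it is
    invertible for substitution. *)
Lemma Exp_inj g h : ord 1 g -> ord 1 h -> Exp g = Exp h -> g = h.
Proof.
move=> og oh E; have o0 := @ord_zero R 1.
apply: (@comp1_inj (expS - 1)) => //.
- by apply/ord1P; rewrite serBE ser1E /expS /= invr1 subrr.
- by rewrite serBE ser1E /expS /= invr1 subr0 oner_eq0.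
- by rewrite !compB !comp1 // E.
Qed.

Lemma Exp_surj A : A 0%N 0%N = 1 -> exists h,
  [/\ ord 1 h, Exp h = A & diag A -> diag h].
Proof.
move=> A0; have o0 := @ord_zero R 1.
have [| | |h [oh E dh _]] := @comp1_surj (expS - 1) _ _ (A - 1).
- by apply/ord1P; rewrite serBE ser1E /expS /= invr1 subrr.
- by rewrite serBE ser1E /expS /= invr1 subr0 oner_eq0.
- by apply/ord1P; rewrite serBE ser1E A0 subrr.
exists h; split=> // [|dA].
  by move: E; rewrite compB comp1 // => /addIr.
by apply/dh/diagD => //; apply/diagN/diag1.
Qed.

Lemma Exp_monom c n a b : (0 < n)%N ->
  Exp (cst c * (X * Y) ^+ n) a b =
  if (n %| b)%N && (a == b) then c ^+ (b %/ n) / (b %/ n)`!%:R else 0.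
Proof.
move=> n0; rewrite ser_exp_coef.
have E j : ((cst c * (X * Y) ^+ n) ^+ j) a b =
    c ^+ j * ((a == n * j)%N && (b == n * j)%N)%:R.
  rewrite -monomE -cstM; congr ((_ : ser) a b).
  by rewrite exprMn -exprM exprMn rmorphXn.
case: ifP => [/andP[/dvdnP[q bE] /eqP aE]|nd].
  move: E; rewrite aE bE => E.
  have qS : (q < (q * n + q * n).+1)%N by nia.
  rewrite (bigD1 (Ordinal qS)) //= E [(n * q)%N]mulnC eqxx mulnK //.
  rewrite mulr1 [RHS]mulrC big1 ?addr0 //.
  move=> j jq; rewrite E [(n * j)%N]mulnC eqn_pmul2r // andbb.
  case: (q =P _) => [e|]; rewrite ?mulr0 //.
  by case/eqP: jq; apply: val_inj.
rewrite big1 // => j _; rewrite E; case: (b =P _) => [e|]; last by rewrite andbF !mulr0.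
case: (a =P _) => [e'|]; last by rewrite !mulr0.
by exfalso; move: (nat_of_ord j) e e' nd => m -> ->; rewrite dvdn_mulr // eqxx.
Qed.

End Diagonal.

(** * Rotations *)

Section Structure.
Variable R : realType.
Local Notation C := R[i].
Local Notation ser := (ser R).
Local Notation X := (ser_X R).
Local Notation Y := (ser_Y R).
Local Notation Exp g := (ser_comp (expS R) g 0).
Implicit Types (f g h A B k : ser) (lam eps : C) (s : option nat).

(** For |lam| = 1 and k a real series in XY, this formally rotates each circle XY = const of the
    plane eta = conj xi, the fixed set of rho, by the angle arg lam + k. *)
Definition twist lam k : fmap R :=
  (cst lam * (X * Exp (cst 'i * k)), cst lam^* * (Y * Exp (- (cst 'i * k)))).

Definition rotation_angle eps s : ser :=
  if s is Some n then cst eps * (X * Y) ^+ n else 0.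

Lemma ord_rotation_angle eps s : valid_invariants eps s ->
  ord 1 (rotation_angle eps s).
Proof.
case=> [[_ ->]//|[_ [[|n] [-> //]]] _ /=]; apply: ordMl.
by rewrite exprS -mulrA; apply: ordMr; exact: ord_X.
Qed.

Lemma diag_XY : diag (X * Y).
Proof. by move=> a b ab; rewrite mulXE; case: a ab => // a; case: b => [|[|b]]; case: a. Qed.

Lemma diag_rotation_angle eps s : diag (rotation_angle eps s).
Proof.
case: s => [n|] //; apply: diagM; first exact: diag_cst.
by apply: diagX; exact: diag_XY.
Qed.

Lemma normal_form_twist lam eps s : valid_invariants eps s ->
  normal_form lam eps s = twist lam (rotation_angle eps s).
Proof.
case=> [[-> ->]|[_ [n [-> n0]]]] /=; rewrite /twist /rotation_angle.
  by rewrite mulr0 oppr0 Exp0 !mulr1 !scaleE.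
have e : cst 'i * (cst eps * (X * Y) ^+ n) = cst ('i * eps) * (X * Y) ^+ n.
  by rewrite rmorphM mulrA.
have eN : - (cst ('i * eps) * (X * Y) ^+ n) = cst (- ('i * eps)) * (X * Y) ^+ n.
  by rewrite rmorphN mulNr.
rewrite e eN; congr pair; apply: serP => a b.
  rewrite cstM mulXE n0 /=; case: a => [|a]; first by rewrite andbF mulr0.
  rewrite Exp_monom // eqSS; case: ifP => _; rewrite ?mulr0 //.
  by rewrite mulrA.
rewrite cstM mulYE n0 /=; case: b => [|b]; first by rewrite andbF mulr0.
rewrite Exp_monom // eqSS [b == a]eq_sym; have [->|ab] := eqVneq a b.
  by case: ifP => _; rewrite ?mulr0 // mulrA.
by rewrite !andbF mulr0.
Qed.

Lemma ord1_cst c k : ord 1 k -> ord 1 (cst c * k).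
Proof. by move=> ?; apply: ordMl. Qed.

Lemma nc_twist lam k : nc (twist lam k).
Proof. by split; apply/ordMl/ordMr; [exact: ord_X|exact: ord_Y]. Qed.

(* The two exponentials cancel in the product of the components. *)
Lemma twist_diag lam k A : lam * lam^* = 1 -> ord 1 k -> diag A ->
  ser_comp A (twist lam k).1 (twist lam k).2 = A.
Proof.
move=> l1 k1 dA; rewrite -[RHS]comp_id; apply: diag_comp_eq => //=.
have E := ExpN (ord1_cst 'i k1).
transitivity (cst (lam * lam^*) * (X * Y) * (Exp (cst 'i * k) * Exp (- (cst 'i * k)))).
  by rewrite rmorphM /=; ring.
by rewrite E l1 rmorph1; ring.
Qed.

(* At the lowest degree n of d = g - 1, the hypothesis reads 2 d = 0. *)
Lemma diag_involution_eq1 (lam : C) g M : lam * lam^* = 1 -> diag g -> g 0%N 0%N = 1 ->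
  agree 2 M (lin lam) -> g * ser_comp g M.1 M.2 = 1 -> g = 1.
Proof.
move=> l1 dg g0 aM E; have [oM1 oM2] := agree2_nc aM (nc_lin lam).
have [? ?] := nc_lin lam; have [aM1 aM2] := aM.
pose d := g - 1; have gE : g = 1 + d by rewrite addrC subrK.
have dd : diag d by apply: diagD => //; apply/diagN/diag1.
have d00 : d 0%N 0%N = 0 by rewrite /d serBE g0 ser1E subrr.
clearbody d.
have dlin : ser_comp d (lin lam).1 (lin lam).2 = d.
  apply: serP => a b; rewrite comp_lin.
  have [->|ab] := eqVneq a b; last by rewrite dd ?mulr0.
  by rewrite -exprMn l1 expr1n mul1r.
suff d0 : d = 0 by rewrite gE d0 addr0.
apply: ord_eq => n; rewrite subr0.
elim: n => [|[|n] IHn]; first by [].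
  exact/ord1P.
pose r := ser_comp d M.1 M.2 - d.
have or : ord n.+2 r.
  rewrite /r -{2}dlin; apply: (@ordW _ _ (n.+1 + 2).-1); last by lia.
  exact: comp_sub_ord.
have cE : ser_comp g M.1 M.2 = 1 + (d + r).
  by rewrite gE compD comp1 // /r; ring.
have d2 : cst 2%:R * d = - (d * d + r + d * r).
  move: E; rewrite cE {1}gE rmorph_nat; clearbody r => E.
  transitivity ((1 + d) * (1 + (d + r)) - 1 - (d * d + r + d * r)); first by ring.
  by rewrite E subrr sub0r.
have -> : d = cst 2%:R^-1 * (cst 2%:R * d).
  by rewrite mulrA -rmorphM mulVf ?rmorph1 ?mul1r // pnatr_eq0.
apply: ordMl; rewrite d2; apply: ordN; apply: ordD; first apply: ordD => //.
  by apply: ordW (ordM IHn IHn) _; lia.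
exact: ordMl.
Qed.

Lemma symmetric_resonant_twist lam (N : fmap R) : lam * lam^* = 1 ->
    resonant N -> agree 2 N (lin lam) -> commutes_rho N ->
    fmap_comp N (tau_conj N) = fmap_id R ->
  exists k, [/\ diag k, ord 1 k, ser_conj k = k & N = twist lam k].
Proof.
move=> l1 [r1 r2] aN rhoN NN.
have l0 : lam != 0 := lam_neq0 l1.
pose A : ser := fun a b => if a == b then lam^* * N.1 a.+1 b else 0.
have dA : diag A by move=> a b ab; rewrite /A (negbTE ab).
have N1 : N.1 = cst lam * (X * A).
  apply: serP => a b; rewrite cstM mulXE; case: a => [|a].
    by rewrite mulr0 r1.
  rewrite /A; case: eqP => [->|ab]; first by rewrite mulrA l1 mul1r.
  by rewrite mulr0 r1 //; apply/eqP => -[].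
have N2 : N.2 = cst lam^* * (Y * ser_conj A).
  rewrite -rhoN /= conjswapE N1 !ser_swapM !ser_conjM ser_swap_cst ser_conj_cst.
  by rewrite ser_swap_X ser_conj_Y diag_swap.
have A0 : A 0%N 0%N = 1.
  have := aN.1 1%N 0%N erefl; rewrite serBE /lin /= cstM /ser_X /= mulr1 => /eqP.
  by rewrite subr_eq0 /A /= => /eqP ->; rewrite mulrC.
have nN := agree2_nc aN (nc_lin lam).
have [t1 t2] := nc_tau nN.
have T1 : (tau_conj N).1 = cst lam^* * (X * ser_conj A).
  by rewrite /= N2 !ser_swapM ser_swap_cst ser_swap_Y diag_swap //; exact: diag_conj.
have T2 : (tau_conj N).2 = cst lam * (Y * A).
  by rewrite /= N1 !ser_swapM ser_swap_cst ser_swap_X diag_swap.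
have aT : agree 2 (tau_conj N) (lin lam^*).
  have -> : lin lam^* = tau_conj (lin lam) :> fmap R.
    by rewrite /tau_conj /lin /= !ser_swapM !ser_swap_cst ser_swap_X ser_swap_Y conjCK.
  exact: agree_tau.
move: (tau_conj N) t1 t2 T1 T2 aT NN => M t1 t2 T1 T2 aT NN.
pose B := ser_conj A.
have c1 : cst lam * cst lam^* = 1 by rewrite -rmorphM l1 rmorph1.
have E1 : B * ser_comp A M.1 M.2 = 1.
  apply: mulX_inj; rewrite mulr1; have /= := congr1 fst NN.
  rewrite {1}N1 compZ compM // compX // {1}T1 -/B => {2}<-.
  by rewrite -[LHS]mul1r -c1; ring.
have E2 : A * ser_comp B M.1 M.2 = 1.
  apply: mulY_inj; rewrite mulr1; have /= := congr1 snd NN.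
  rewrite {1}N2 compZ compM // compY // {1}T2 -/B => {2}<-.
  by rewrite -[LHS]mul1r -c1; ring.
(* The product of [E1] and [E2] is g (g o M) = 1 for g = AB, which is the hypothesis of
   [diag_involution_eq1]. *)
have AB : A * B = 1.
  apply: (@diag_involution_eq1 lam^* _ M) => //.
  - by rewrite conjCK mulrC.
  - by apply: diagM => //; exact: diag_conj.
  - by rewrite coef00M /B /ser_conj A0 rmorph1 mulr1.
  - rewrite compM // -[RHS]mulr1 -{1}E1 -E2; ring.
(* With h the logarithm of A, AB = 1 says that conj h = - h, so k = - i h is real. *)
have [h [oh Eh dh]] := Exp_surj A0.
have ch : ser_conj h = - h.
  apply: Exp_inj; [exact: ord_conj|exact: ordN|].
  rewrite -ser_conj_Exp Eh -/B -[LHS]mulr1 -(ExpN oh) Eh mulrA [B * A]mulrC AB.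
  by rewrite mul1r.
have ci : cst 'i * cst (- 'i) = 1 :> ser.
  by rewrite -rmorphM mulrN -expr2 sqrCi opprK rmorph1.
have ik : cst 'i * (cst (- 'i) * h) = h by rewrite mulrA ci mul1r.
exists (cst (- 'i) * h); split.
- by apply: diagM; [exact: diag_cst|exact: dh].
- exact: ord1_cst.
- have iC : (- 'i)^* = 'i :> C by rewrite rmorphN /= conjCi opprK.
  by rewrite ser_conjM ser_conj_cst ch iC rmorphN mulrN mulNr.
- rewrite /twist ik Eh [LHS]surjective_pairing N1 N2; congr (_, _ * (_ * _)).
  by rewrite -ch -ser_conj_Exp Eh.
Qed.

Lemma coef10_add1X_exp n : ((1 + X) ^+ n) 1%N 0%N = n%:R.
Proof.
elim: n => [|n IHn]; first by rewrite expr0 ser1E.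
rewrite exprS mulrDl mul1r serDE IHn mulXE coef00X serDE ser1E /ser_X /=.
by rewrite addr0 expr1n -natr1.
Qed.

(** The series (1 + X)^n - 1 has linear coefficient n, which is nonzero, so it takes the value A - 1
    at some g, and B = 1 + g. *)
Lemma real_root n A : (0 < n)%N -> diag A -> ser_conj A = A -> A 0%N 0%N = 1 ->
  exists B, [/\ diag B, ser_conj B = B, B 0%N 0%N = 1 & B ^+ n = A].
Proof.
move=> n0 dA rA A0; have o0 := @ord_zero R 1.
have [| | |g [og E dg rg]] := @comp1_surj _ ((1 + X) ^+ n - 1) _ _ (A - 1).
- by apply/ord1P; rewrite serBE coef00X serDE !ser1E /ser_X /= addr0 expr1n subrr.
- by rewrite serBE coef10_add1X_exp ser1E subr0 pnatr_eq0 -lt0n.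
- by apply/ord1P; rewrite serBE ser1E A0 subrr.
have d1 := @diag1 R.
exists (1 + g); split.
- by apply: diagD => //; apply: dg; apply: diagD => //; exact: diagN.
- rewrite -[g]opprK ser_conjB ser_conj1 ser_conjN rg //.
    by rewrite ser_conjB ser_conjX -[X]opprK ser_conjB !ser_conjN ser_conj1 ser_conj_X.
  by rewrite ser_conjB rA ser_conj1.
- by rewrite serDE ser1E og ?addr0.
- by move: E; rewrite compB comp_exp // compD comp1 // compX // => /addIr.
Qed.

Lemma real_angle_model k : diag k -> ord 1 k -> ser_conj k = k ->
  exists eps s A, [/\ valid_invariants eps s, diag A, ser_conj A = A,
    A 0%N 0%N != 0 & ser_comp (rotation_angle eps s) (X * A) (Y * A) = k].
Proof.
move=> dk ok rk.
have [nz|z] := pselect (exists n, k n n != 0); last first.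
  exists 0, None, 1; split; [by left|exact: diag1|exact: ser_conj1| |].
    by rewrite ser1E oner_eq0.
  rewrite comp0; apply: serP => a b; rewrite ser0E.
  have [->|ab] := eqVneq a b; last by rewrite dk.
  by apply/esym/eqP; apply: contra_notT z => kb; exists b.
have [n kn nmin] := ex_minnP nz.
have n0 : (0 < n)%N by case: n kn {nmin} => //; rewrite ok ?eqxx.
pose c := k n n.
have cr : c \is Num.real.
  by rewrite CrealE /c -{2}rk.
pose mu := `|c|.
have mu0 : 0 < mu by rewrite normr_gt0.
pose eps : C := if 0 < c then 1 else -1.
have epsc : eps * c = mu.
  rewrite /eps /mu; case: ifP => [/gtr0_norm ->|]; first by rewrite mul1r.
  by rewrite real_ltNge ?rpred0 // => /negbFE /ler0_norm ->; rewrite mulN1r.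
have eps2 : eps * eps = 1 by rewrite /eps; case: ifP; rewrite ?mulr1 // mulrNN mulr1.
have eps1 : eps = 1 \/ eps = -1 by rewrite /eps; case: ifP; [left|right].
pose K : ser := fun a b => if a == b then c^-1 * k (a + n)%N (b + n)%N else 0.
have kE : k = (X * Y) ^+ n * (cst c * K).
  apply: serP => a b; rewrite mulXYn cstM /K.
  case: ifP => [/andP[na nb]|nab].
    rewrite eqn_sub2rE // ?subnK //; have [->|ab] := eqVneq a b.
      by rewrite mulrA mulfV // mul1r.
    by rewrite mulr0 dk.
  have [ab|ab] := eqVneq a b; last by rewrite dk.
  apply/eqP; move: nab; rewrite ab andbb => nb.
  by apply: contraFT nb => /nmin.
have [B [dB rB B0 BE]] : exists B, [/\ diag B, ser_conj B = B, B 0%N 0%N = 1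
    & B ^+ (n + n) = K].
  apply: real_root.
  - by rewrite addn_gt0 n0.
  - by move=> a b ab; rewrite /K (negbTE ab).
  - apply: serP => a b; rewrite /ser_conj /K; case: ifP => _; last by rewrite rmorph0.
    rewrite rmorphM fmorphV /= (conj_Creal cr); congr (_ * _).
    by rewrite -[in RHS]rk.
  - by rewrite /K /= !add0n mulVf.
(* [K] was scaled to constant term 1 for [real_root]; the remaining modulus [mu] is absorbed by this
   positive number. *)
pose a := (n + n).-root mu.
have nn0 : (0 < n + n)%N by rewrite addn_gt0 n0.
have aE : a ^+ (n + n) = mu by rewrite rootCK.
have a0 : 0 < a by rewrite rootC_gt0.
exists eps, (Some n), (cst a * B); split.
- by right; split=> //; exists n.
- by apply: diagM => //; exact: diag_cst.
- by rewrite ser_conjM ser_conj_cst rB conj_Creal // gtr0_real.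
- by rewrite coef00M B0 mulr1 /cst /= lt0r_neq0.
have oX : ord 1 (X * (cst a * B)) by apply: ordMr; exact: ord_X.
have oY : ord 1 (Y * (cst a * B)) by apply: ordMr; exact: ord_Y.
rewrite /= compZ comp_exp // compM // compX // compY //.
transitivity ((X * Y) ^+ n * (cst eps * cst (a ^+ (n + n)) * B ^+ (n + n))).
  by rewrite !exprMn !rmorphXn !exprD; ring.
rewrite aE BE [RHS]kE -epsc rmorphM /= (mulrA (cst eps)) -rmorphM eps2 rmorph1.
by rewrite mul1r.
Qed.

(** A twist preserves XY, hence fixes A and B, so (X A, Y B) acts on twists merely by substitution
    into the angle. *)
Lemma twist_conj lam A B w : lam * lam^* = 1 -> diag A -> diag B -> ord 1 w ->
  fmap_comp (X * A, Y * B) (twist lam (ser_comp w (X * A) (Y * B))) =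
  fmap_comp (twist lam w) (X * A, Y * B).
Proof.
move=> l1 dA dB ow.
have oX : ord 1 (X * A) by apply: ordMr; exact: ord_X.
have oY : ord 1 (Y * B) by apply: ordMr; exact: ord_Y.
have ok : ord 1 (ser_comp w (X * A) (Y * B)) by apply: comp_ord.
have [t1 t2] := nc_twist lam (ser_comp w (X * A) (Y * B)).
have ow' := ord1_cst 'i ow; have o0 := @ord_zero R 1.
rewrite /fmap_comp; congr pair.
  rewrite [LHS]compM // compX // twist_diag //=.
  rewrite compZ compM // compX // comp_assoc // comp0 compZ; ring.
rewrite [LHS]compM // compY // twist_diag //=.
rewrite compZ compM // compY // comp_assoc //; last exact: ordN.
rewrite comp0 compN compZ; ring.
Qed.

End Structure.

(** * Invariants *)

Section Invariants.
Variable R : realType.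
Local Notation C := R[i].
Local Notation ser := (ser R).
Local Notation X := (ser_X R).
Local Notation Y := (ser_Y R).
Implicit Types (f g h A B k w : ser) (lam eps : C) (s : option nat).
Implicit Types (N M Th : fmap R).

Lemma diag_resonant lam A B : diag A -> diag B ->
  resonant (cst lam * (X * A), cst lam^* * (Y * B)).
Proof.
move=> dA dB; split=> a b r; rewrite /= cstM ?mulXE ?mulYE.
  by case: a r => [|a] r; rewrite ?mulr0 // dA ?mulr0 //.
case: b r => [|b] r; rewrite ?mulr0 // dB ?mulr0 //.
by rewrite eq_sym.
Qed.

Lemma twist_resonant lam k : diag k -> resonant (twist lam k).
Proof.
move=> dk; have dik : diag (cst 'i * k) by apply: diagM => //; exact: diag_cst.
by apply: diag_resonant; apply: diag_comp => //; exact: diagN.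
Qed.

Lemma twist_agree lam k : ord 1 k -> agree 2 (twist lam k) (lin lam).
Proof.
move=> ok; have oik := ord1_cst 'i ok.
have H c W (g : ser) : ord 1 W -> ord 1 g ->
    ord 2 (cst c * (W * ser_comp (expS R) g 0) - cst c * W).
  move=> oW og; rewrite -mulrBr -{2}[W]mulr1 -mulrBr; apply: ordMl.
  apply: (@ordM _ 1 1) => //; apply/ord1P.
  by rewrite serBE Exp_coef00 // ser1E subrr.
by split; apply: H => //; [exact: ord_X|exact: ord_Y|exact: ordN].
Qed.

Lemma lin_inverse lam : lam * lam^* = 1 ->
  fmap_comp (lin lam^*) (lin lam) = fmap_id R /\
  fmap_comp (lin lam) (lin lam^*) = fmap_id R.
Proof.
move=> l1; have c1 : cst lam * cst lam^* = 1 by rewrite -rmorphM l1 rmorph1.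
have [n1 n2] := nc_lin lam; have [n3 n4] := nc_lin lam^*.
split; rewrite /fmap_comp /fmap_id; congr pair.
- by rewrite compZ compX //= mulrA [cst lam^* * _]mulrC c1 mul1r.
- by rewrite compZ compY //= conjCK mulrA c1 mul1r.
- by rewrite compZ compX //= mulrA c1 mul1r.
- by rewrite compZ compY //= conjCK mulrA [cst lam^* * _]mulrC c1 mul1r.
Qed.

Section Conjugation.
Variable lam : C.
Hypothesis lam_unit : lam * lam^* = 1.
Hypothesis lam_nroot : forall n, (0 < n)%N -> lam ^+ n <> 1.
Local Notation L := (lin lam).

(* At degree n the difference f' - f lies both in the kernel and in the image of
   the diagonal operator f |-> f o L - mu f, hence vanishes. *)
Lemma eigen_step n mu nu (W M : ser) f f' N Th Th' : (0 < n)%N ->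
    agree 2 N L -> ord 2 (M - cst mu * W) -> nc Th -> nc Th' ->
    agree n Th' Th -> ord n (f' - f) ->
    ser_comp f N.1 N.2 = ser_comp M Th.1 Th.2 ->
    ser_comp f' N.1 N.2 = ser_comp M Th'.1 Th'.2 ->
    ser_comp W Th.1 Th.2 = f -> ser_comp W Th'.1 Th'.2 = f' ->
    (forall a b, (f' - f) a b = nu * (lam ^+ a * lam^* ^+ b - mu) * f a b) ->
  ord n.+1 (f' - f).
Proof.
move=> n0 aN oM [? ?] [? ?] [aT1 aT2] od E E' Wf Wf' dE.
have [? ?] := agree2_nc aN (nc_lin lam); have [aN1 aN2] := aN.
have [? ?] := nc_lin lam.
have key : ord n.+1 (ser_comp (f' - f) L.1 L.2 - cst mu * (f' - f)).
  have -> : ser_comp (f' - f) L.1 L.2 - cst mu * (f' - f) =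
      ser_comp (M - cst mu * W) Th'.1 Th'.2 - ser_comp (M - cst mu * W) Th.1 Th.2
      - (ser_comp (f' - f) N.1 N.2 - ser_comp (f' - f) L.1 L.2).
    by rewrite !compB !compZ E E' Wf Wf'; ring.
  apply: ordB.
    by apply: (@ordW _ _ (2 + n).-1) => //; apply: comp_sub_ord.
  by apply: (@ordW _ _ (n + 2).-1); [exact: comp_sub_ord|lia].
move=> a b ab; have := key a b ab.
rewrite serBE comp_lin cstM -mulrBl => /eqP; rewrite mulf_eq0 => /orP[|/eqP //].
by move=> /eqP e; rewrite dE e mulr0 mul0r.
Qed.

Lemma conjugator_resonant N M Th : agree 2 N L -> agree 2 M L ->
    resonant N -> resonant M -> nc Th ->
  fmap_comp Th N = fmap_comp M Th -> resonant Th.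
Proof.
move=> aN aM rN rM nT E.
have nL := nc_lin lam; have nK := nc_lin lam^*.
have nN := agree2_nc aN nL; have nM := agree2_nc aM nL.
have NL := (resonant_commutes lam_unit lam_nroot nN).1 rN.
have ML := (resonant_commutes lam_unit lam_nroot nM).1 rM.
have [KL LK] := lin_inverse lam_unit.
set K := lin lam^* in nK KL LK.
have KM : fmap_comp K M = fmap_comp M K.
  have nMK := nc_comp nM nK.
  transitivity (fmap_comp K (fmap_comp (fmap_comp M L) K)).
    by rewrite fmap_compA // LK fmap_comp_id.
  by rewrite ML fmap_compA // -fmap_compA // KL fmap_id_comp.
pose Th' := fmap_comp K (fmap_comp Th L).
have nT' : nc Th' by do 2?apply: nc_comp.
have E' : fmap_comp Th' N = fmap_comp M Th'.
  have nTL := nc_comp nT nL; have nMT := nc_comp nM nT.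
  transitivity (fmap_comp K (fmap_comp (fmap_comp Th N) L)).
    by rewrite /Th' !fmap_compA // NL.
  transitivity (fmap_comp (fmap_comp K M) (fmap_comp Th L)).
    by rewrite E !fmap_compA.
  by rewrite KM fmap_compA.
(* The difference is conj(lam) times Th.1 o L - lam Th.1, so it lies in the image of the operator,
   as [eigen_step] requires. *)
have T1 a b : (Th'.1 - Th.1) a b = lam^* * (lam ^+ a * lam^* ^+ b - lam) * Th.1 a b.
  rewrite serBE /Th' /= compZ compX ?cstM; try by apply: comp_ord; case: nT; case: nL.
  transitivity (lam^* * (lam ^+ a * lam^* ^+ b) * Th.1 a b
    - lam * lam^* * Th.1 a b); last by ring.
  by rewrite comp_lin lam_unit mul1r !mulrA.
have T2 a b : (Th'.2 - Th.2) a b = lam * (lam ^+ a * lam^* ^+ b - lam^*) * Th.2 a b.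
  rewrite serBE /Th' /= compZ compY ?cstM ?conjCK; try by apply: comp_ord; case: nT; case: nL.
  transitivity (lam * (lam ^+ a * lam^* ^+ b) * Th.2 a b
    - lam * lam^* * Th.2 a b); last by ring.
  by rewrite comp_lin lam_unit mul1r !mulrA.
have [nT1 nT2] := nT; have [nT1' nT2'] := nT'.
have TT : Th' = Th.
  apply: agree_eq; elim=> [|[|n] IHn]; [by []|by split; apply: ordB|].
  split.
    apply: (eigen_step _ aN (aM.1) nT nT' IHn IHn.1 _ _ _ _ T1) => //.
    - by have := congr1 fst E.
    - by have := congr1 fst E'.
    - by rewrite compX.
    - by rewrite compX.
  apply: (eigen_step _ aN (aM.2) nT nT' IHn IHn.2 _ _ _ _ T2) => //.
  - by have := congr1 snd E.
  - by have := congr1 snd E'.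
  - by rewrite compY.
  - by rewrite compY.
apply/(resonant_commutes lam_unit lam_nroot nT).
rewrite -{2}TT /Th' -fmap_compA ?LK ?fmap_id_comp //; exact: nc_comp.
Qed.

(** Substitution turns u^m into u^m (AB)^m, with leading coefficient t^m nonzero, so the lowest
    degrees coincide. Then eps1 = eps2 t^m with t^m > 0 forces equal signs. *)
Lemma rotation_angle_invariant eps1 s1 eps2 s2 A B t :
    valid_invariants eps1 s1 -> valid_invariants eps2 s2 ->
    A 0%N 0%N * B 0%N 0%N = t -> 0 < t ->
    rotation_angle eps1 s1 =
      ser_comp (rotation_angle eps2 s2) (X * A) (Y * B) ->
  eps1 = eps2 /\ s1 = s2.
Proof.
move=> v1 v2 tE t0.
have oX : ord 1 (X * A) by apply: ordMr; exact: ord_X.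
have oY : ord 1 (Y * B) by apply: ordMr; exact: ord_Y.
have rot eps n D m : (cst eps * ((X * Y) ^+ n * D)) m m =
    if (n <= m)%N then eps * D (m - n)%N (m - n)%N else 0.
  by rewrite cstM mulXYn andbb; case: ifP; rewrite ?mulr0.
have comp_rot eps n : ser_comp (cst eps * (X * Y) ^+ n) (X * A) (Y * B) =
    cst eps * ((X * Y) ^+ n * (A * B) ^+ n).
  by rewrite compZ comp_exp // compM // compX // compY // -exprMn mulrACA.
have eps0 eps : eps = 1 \/ eps = -1 -> eps != 0.
  by case=> ->; rewrite ?oppr_eq0 oner_eq0.
have D0 n : ((A * B) ^+ n) 0%N 0%N = t ^+ n by rewrite coef00X coef00M tE.
have tn n : t ^+ n != 0 by rewrite expf_neq0 // lt0r_neq0.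
case: v1 => [[-> ->]|[e1 [n [-> n0]]]]; case: v2 => [[-> ->]|[e2 [m [-> m0]]]] //=.
- rewrite comp_rot => /(congr1 (fun f : ser => f m m)); rewrite rot leqnn subnn D0.
  by move/esym/eqP; rewrite mulf_eq0 (negbTE (tn m)) (negbTE (eps0 _ e2)).
- rewrite comp0 -[_ ^+ n]mulr1 => /(congr1 (fun f : ser => f n n)).
  by rewrite rot leqnn subnn mulr1 => /eqP; rewrite (negbTE (eps0 _ e1)).
- rewrite comp_rot -[_ ^+ n in LHS]mulr1 => E.
  have En := congr1 (fun f : ser => f n n) E.
  have Em := congr1 (fun f : ser => f m m) E.
  rewrite /= !rot !leqnn !subnn D0 mulr1 in En Em.
  have nm : n = m.
    apply/eqP; rewrite eqn_leq; apply/andP; split.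
      move: Em; case: ifP => // _ /esym/eqP.
      by rewrite mulf_eq0 (negbTE (tn m)) (negbTE (eps0 _ e2)).
    by move: En; case: ifP => // _ /eqP; rewrite (negbTE (eps0 _ e1)).
  split; last by rewrite nm.
  move: En; rewrite nm leqnn subnn D0; have := exprn_gt0 m t0; move: (t ^+ m) => u u0.
  case: e1 => ->; case: e2 => -> //; rewrite ?mul1r ?mulN1r => ue.
    by move: u0; rewrite -[u]opprK -ue oppr_gt0 ltr10.
  by move: u0; rewrite -ue oppr_gt0 ltr10.
Qed.

Lemma twist_invariants eps1 s1 eps2 s2 Th :
    valid_invariants eps1 s1 -> valid_invariants eps2 s2 ->
    formal_transformation Th -> commutes_rho Th ->
    fmap_comp Th (twist lam (rotation_angle eps1 s1)) =
      fmap_comp (twist lam (rotation_angle eps2 s2)) Th ->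
  eps1 = eps2 /\ s1 = s2.
Proof.
move=> v1 v2 tT rT E.
have o1 := ord_rotation_angle v1; have o2 := ord_rotation_angle v2.
have nT := formal_transformation_nc tT.
have [r1 r2] : resonant Th.
  apply: conjugator_resonant E => //; try exact: twist_agree;
    apply: twist_resonant; exact: diag_rotation_angle.
pose A : ser := fun a b => if a == b then Th.1 a.+1 b else 0.
have dA : diag A by move=> a b ab; rewrite /A (negbTE ab).
have T1 : Th.1 = X * A.
  apply: serP => a b; rewrite mulXE; case: a => [|a]; first by rewrite r1.
  rewrite /A; case: eqP => [-> //|ab].
  by rewrite r1 //; apply/eqP => -[].
have T2 : Th.2 = Y * ser_conj A.
  by rewrite -rT /= conjswapE T1 !ser_swapM !ser_conjM ser_swap_X ser_conj_Y diag_swap.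
have dB := diag_conj dA.
(* Resonance kills the coefficient of Y in Th.1, so the Jacobian would vanish together with A(0). *)
have A0 : A 0%N 0%N != 0.
  have /formal_transformationP[_] := tT; apply: contraNneq => A0.
  by rewrite /jacobian -[Th.1 1%N 0%N]/(A 0%N 0%N) A0 mul0r r1 // mul0r subr0.
have TE : Th = (X * A, Y * ser_conj A) by rewrite -T1 -T2 -surjective_pairing.
apply: (rotation_angle_invariant (A := A) (B := ser_conj A) v1 v2 erefl).
  by rewrite /ser_conj mul_conjC_gt0.
(* Both the first twist and the twist by the pulled back second angle are conjugated by Th to the
   second twist. Cancelling Th and taking logarithms equates their angles. *)
have := twist_conj lam_unit dA dB o2; rewrite -TE -E.
move=> /(comp_injl tT (nc_twist _ _) (nc_twist _ _)) /(congr1 fst) /=.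
have c1 : cst lam^* * cst lam = 1 by rewrite -rmorphM mulrC lam_unit rmorph1.
move=> /(congr1 (fun f => cst lam^* * f)); rewrite !mulrA c1 !mul1r.
move=> /mulX_inj /Exp_inj - /(_ _ _)/esym.
have [nT1 nT2] := nT; rewrite -T1 -T2 => H.
have ci : cst (- 'i) * cst 'i = 1 :> ser.
  by rewrite -rmorphM mulNr -expr2 sqrCi opprK rmorph1.
rewrite -[LHS]mul1r -[RHS]mul1r -ci -!mulrA; congr (_ * _); apply: H.
  by apply/ord1_cst/comp_ord.
exact: ord1_cst.
Qed.

End Conjugation.
End Invariants.

(** * Multipliers of admissible maps and existence of the normal form *)

Section Admissible.
Variable R : realType.
Local Notation C := R[i].
Local Notation ser := (ser R).
Local Notation X := (ser_X R).
Local Notation Y := (ser_Y R).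
Implicit Types (lam eps : C) (s : option nat) (p q : ser) (F G Phi Psi : fmap R).

Lemma phi_map_agree lam p q : order_ge2 p -> order_ge2 q ->
  agree 2 (phi_map lam p q) (lin lam).
Proof.
move=> op oq; split=> a b ab; rewrite serBE /= scaleE.
  by rewrite /ser_add op // addr0 subrr.
by rewrite /ser_add oq // addr0 subrr.
Qed.

(** Reversibility read on the coefficient of X: the linear part of tau phi tau is diag(conj lam,
    lam). *)
Lemma admissible_unit lam p q : admissible lam p q -> lam * lam^* = 1.
Proof.
case=> _ [_ [op [oq [_ [[E _] _]]]]]; have aphi := phi_map_agree lam op oq.
have [n1 n2] := agree2_nc aphi (nc_lin lam).
have [t1 t2] := nc_tau (conj n1 n2).
have := congr1 (fun F : fmap R => F.1 1%N 0%N) E.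
rewrite /= comp_linear // /tau_conj /ser_swap /= /ser_add /ser_scale /ser_X /ser_Y.
by rewrite !op // !oq // !mulr1 !mulr0 !addr0 mul0r addr0.
Qed.

Lemma admissible_nroot lam p q : admissible lam p q ->
  forall n, (0 < n)%N -> lam ^+ n <> 1.
Proof.
by case=> _ [_ [_ [_ [_ [_ [_ nr]]]]]] n n0 E; apply: nr; exists n.
Qed.

Lemma admissible_agree lam p q : admissible lam p q ->
  agree 2 (phi_map lam p q) (lin lam).
Proof. by case=> _ [_ [op [oq _]]]; exact: phi_map_agree. Qed.

(** The first row of the linear part of Psi is nonzero and intertwines the two diagonal parts, so
    lam2 is lam1 or its conjugate; the signs of the imaginary parts exclude the conjugate. *)
Lemma multiplier_invariant lam1 lam2 F G Psi :
    agree 2 F (lin lam1) -> agree 2 G (lin lam2) ->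
    0 < complex.Im lam1 -> 0 < complex.Im lam2 ->
    formal_transformation Psi ->
    fmap_comp Psi F = fmap_comp G Psi -> lam1 = lam2.
Proof.
move=> aF aG i1 i2 /formal_transformationP[[P1 P2] jP] E.
have [F1 F2] := agree2_nc aF (nc_lin lam1).
have [G1 G2] := agree2_nc aG (nc_lin lam2).
have cF1 a b : (a + b < 2)%N -> F.1 a b = lam1 * X a b.
  by move=> ab; apply/eqP; rewrite -subr_eq0 -cstM -serBE aF.1.
have cF2 a b : (a + b < 2)%N -> F.2 a b = lam1^* * Y a b.
  by move=> ab; apply/eqP; rewrite -subr_eq0 -cstM -serBE aF.2.
have cG1 a b : (a + b < 2)%N -> G.1 a b = lam2 * X a b.
  by move=> ab; apply/eqP; rewrite -subr_eq0 -cstM -serBE aG.1.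
have E10 := congr1 (fun H : fmap R => H.1 1%N 0%N) E.
have E01 := congr1 (fun H : fmap R => H.1 0%N 1%N) E.
rewrite /= !comp_linear // !cF1 // !cF2 // !cG1 // /ser_X /ser_Y /= in E10 E01.
rewrite !mulr1 !mulr0 mul0r !addr0 mulrC in E10.
rewrite !mulr1 !mulr0 mul0r add0r addr0 mulrC in E01.
have [P10|P10] := eqVneq (Psi.1 1%N 0%N) 0; last exact: (mulIf P10).
have P01 : Psi.1 0%N 1%N != 0.
  by apply: contraNneq jP => P01; rewrite /jacobian P10 P01 !mul0r subrr.
have l12 : lam1^* = lam2 := mulIf P01 E01.
by move: i2; rewrite -l12; case: (lam1) i1 => a b /=; rewrite oppr_gt0 => /lt_gtF ->.
Qed.

Lemma normal_form_exists lam p q : admissible lam p q ->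
  exists eps s Phi, valid_invariants eps s /\
    formal_transformation Phi /\ commutes_rho Phi /\ commutes_tau Phi /\
    fmap_comp Phi (phi_map lam p q) = fmap_comp (normal_form lam eps s) Phi.
Proof.
move=> adm; have l1 := admissible_unit adm; have nr := admissible_nroot adm.
have aphi := admissible_agree adm.
have [_ [_ [_ [_ [_ [rev [rho _]]]]]]] := adm.
have [Phi [N [[nPhi [rPhi tPhi]] rN aN E [rhoN NN]]]] :=
  nf_symmetric l1 nr aphi rho rev.
have [k [dk ok rk NE]] := symmetric_resonant_twist l1 rN aN rhoN NN.
have [eps [s [A [v dA rA A0 kE]]]] := real_angle_model dk ok rk.
pose P : fmap R := (X * A, Y * A).
have ncPhi : nc Phi := agree2_nc (let: And3 a _ _ := nPhi in a) (@nc_id R).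
have ncP : nc P by split; apply: ordMr; [exact: ord_X|exact: ord_Y].
have tP : formal_transformation P.
  apply/formal_transformationP; split=> //.
  rewrite /jacobian /= !mulXE !mulYE mulr0 subr0 mulf_neq0 //.
have tPhi' : formal_transformation Phi.
  apply/formal_transformationP; split=> //.
  have [aP _ _] := nPhi.
  have E1 a b : (a + b < 2)%N -> Phi.1 a b = X a b.
    by move=> ab; apply/eqP; rewrite -subr_eq0 -serBE aP.1.
  have E2 a b : (a + b < 2)%N -> Phi.2 a b = Y a b.
    by move=> ab; apply/eqP; rewrite -subr_eq0 -serBE aP.2.
  by rewrite /jacobian !E1 // !E2 // -/(jacobian (fmap_id R)) jacobian_id oner_eq0.
have rP : commutes_rho P.
  by rewrite /commutes_rho /rho_conj /= !conjswapE !ser_swapM !ser_conjM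
    ser_swap_X ser_swap_Y diag_swap // rA ser_conj_X ser_conj_Y.
have tauP : commutes_tau P.
  by rewrite /commutes_tau /tau_conj /= !ser_swapM ser_swap_X ser_swap_Y diag_swap.
exists eps, s, (fmap_comp P Phi); split=> //; split; last split; last split.
- exact: formal_transformation_comp.
- by rewrite /commutes_rho rho_comp rP rPhi.
- by rewrite /commutes_tau tau_comp tauP tPhi.
have nphi := agree2_nc aphi (nc_lin lam).
rewrite normal_form_twist // fmap_compA // E NE.
rewrite -fmap_compA //; last exact: nc_twist.
have o1 := ord_rotation_angle v.
by rewrite -kE twist_conj // fmap_compA.
Qed.

End Admissible.

Unset Implicit Arguments.

Theorem theorem2p1 (R : realType) :
  (* existence of the normal form *)
  (forall (lam : R[i]) (p q : ser R),
     admissible lam p q ->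
     exists (eps : R[i]) (s : option nat) (Phi : fmap R),
       valid_invariants eps s /\
       formal_transformation Phi /\ commutes_rho Phi /\ commutes_tau Phi /\
       fmap_comp Phi (phi_map lam p q) = fmap_comp (normal_form lam eps s) Phi)
  /\
  (* {lam, eps, s} is a full set of invariants under real formal transformations *)
  (forall (lam1 lam2 : R[i]) (p1 q1 p2 q2 : ser R)
          (eps1 eps2 : R[i]) (s1 s2 : option nat) (Phi1 Phi2 : fmap R),
     admissible lam1 p1 q1 -> admissible lam2 p2 q2 ->
     valid_invariants eps1 s1 -> valid_invariants eps2 s2 ->
     formal_transformation Phi1 -> commutes_rho Phi1 -> commutes_tau Phi1 ->
     fmap_comp Phi1 (phi_map lam1 p1 q1) = fmap_comp (normal_form lam1 eps1 s1) Phi1 ->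
     formal_transformation Phi2 -> commutes_rho Phi2 -> commutes_tau Phi2 ->
     fmap_comp Phi2 (phi_map lam2 p2 q2) = fmap_comp (normal_form lam2 eps2 s2) Phi2 ->
     ((exists Psi : fmap R,
         formal_transformation Psi /\ commutes_rho Psi /\
         fmap_comp Psi (phi_map lam1 p1 q1) = fmap_comp (phi_map lam2 p2 q2) Psi)
      <-> (lam1 = lam2 /\ eps1 = eps2 /\ s1 = s2))).
Proof.
split=> [lam p q|]; first exact: normal_form_exists.
move=> lam1 lam2 p1 q1 p2 q2 eps1 eps2 s1 s2 Phi1 Phi2 ad1 ad2 v1 v2.
move=> tP1 rP1 _ E1 tP2 rP2 _ E2.
have a1 := admissible_agree ad1; have a2 := admissible_agree ad2.
have n1 := agree2_nc a1 (nc_lin lam1); have n2 := agree2_nc a2 (nc_lin lam2).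
have nP1 := formal_transformation_nc tP1.
have nP2 := formal_transformation_nc tP2.
have [Q1 [tQ1 PQ1 QP1]] := inverse_exists tP1.
have [Q2 [tQ2 PQ2 QP2]] := inverse_exists tP2.
have nQ1 := formal_transformation_nc tQ1.
have nQ2 := formal_transformation_nc tQ2.
split=> [[Psi [tPsi [rPsi E]]]|[lE [eE sE]]].
  have nPsi := formal_transformation_nc tPsi.
  have lE : lam1 = lam2.
    have [_ [_ [_ [_ [i1 _]]]]] := ad1; have [_ [_ [_ [_ [i2 _]]]]] := ad2.
    exact: multiplier_invariant a1 a2 i1 i2 tPsi E.
  subst lam2; split=> //.
  (* Phi2 Psi Phi1^-1 is real and conjugates the first normal form to the second. *)
  apply: (twist_invariants (admissible_unit ad1) (admissible_nroot ad1) v1 v2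
    (Th := fmap_comp Phi2 (fmap_comp Psi Q1))).
  - by do 2?apply: formal_transformation_comp.
  - by rewrite /commutes_rho !rho_comp rP2 rPsi (rho_inverse nP1 nQ1 PQ1 QP1 rP1).
  rewrite -!normal_form_twist //; apply: (comp_injr tP1).
  have nN1 : nc (normal_form lam1 eps1 s1).
    by rewrite normal_form_twist //; exact: nc_twist.
  have nPQ := nc_comp nPsi nQ1; pose Th := fmap_comp Phi2 (fmap_comp Psi Q1).
  have nTh : nc Th by exact: nc_comp.
  have PQP : fmap_comp Th Phi1 = fmap_comp Phi2 Psi.
    by rewrite !fmap_compA // QP1 fmap_comp_id.
  transitivity (fmap_comp Phi2 (fmap_comp Psi (phi_map lam1 p1 q1))).
    by rewrite (fmap_compA Th) // -E1 -fmap_compA // PQP fmap_compA.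
  rewrite E -fmap_compA // E2.
  by rewrite (fmap_compA _ nP2 nPsi) (fmap_compA _ nTh nP1) PQP.
exists (fmap_comp Q2 Phi1); split; first exact: formal_transformation_comp.
split; first by rewrite /commutes_rho rho_comp rP1 (rho_inverse nP2 nQ2 PQ2 QP2 rP2).
rewrite fmap_compA // E1 lE eE sE; apply: (comp_injl tP2).
- by apply: nc_comp => //; apply: nc_comp => //; rewrite normal_form_twist //; exact: nc_twist.
- by apply: nc_comp => //; exact: nc_comp.
have nQP := nc_comp nQ2 nP1.
rewrite -fmap_compA //; last first.
  by apply: nc_comp => //; rewrite normal_form_twist //; exact: nc_twist.
rewrite PQ2 fmap_id_comp -?fmap_compA //; last first.
  by apply: nc_comp => //; rewrite normal_form_twist //; exact: nc_twist.
rewrite E2 !fmap_compA // -(fmap_compA Phi2) // PQ2 fmap_id_comp //.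
Qed.
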